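(* Let $d,n\ge 1$, let $0<\mu\le L$, $\kappa:=L/\mu$, and let $f_1,\dots,f_n,g:\mathbb{R}^d\to\mathbb{R}$ be differentiable functions that are all $L$-smooth and $\mu$-strongly convex. Let $x^\star$ be the unique minimizer over $\mathbb{R}^d$ of $\frac1n\sum_{i=1}^n f_i+g$. Consider the LoCoDL algorithm (defined in the context) in which the compressors $(\mathcal{C}_i^t)_{i\in[n],\,t\ge0}$ are mutually independent rand-$k$ compressors with $k=\lceil d/n\rceil$ and $\omega=\frac dk-1$. Suppose that $0<\gamma<\frac2L$ with $\gamma=\Theta(\frac1L)$, that $$\chi=\rho=\frac{n}{n-1+d/k},$$ and that $$p=\min\left(\sqrt{\frac{dk(n-1)+d^2}{nk^2\kappa}},\,1\right).$$ Then the uplink communication complexity of LoCoDL, in number of reals, to reach $\epsilon$-accuracy is $$\mathcal{O}\left(\left(\sqrt d\sqrt\kappa+\frac{d\sqrt\kappa}{\sqrt n}+d\right)\log\epsilon^{-1}\right).$$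
   Context: Notation: $[n]=\{1,\dots,n\}$; $\|\cdot\|$ is the Euclidean norm. A differentiable $f:\mathbb{R}^d\to\mathbb{R}$ is $L$-smooth if $\|\nabla f(x)-\nabla f(y)\|\le L\|x-y\|$ for all $x,y$; it is $\mu$-strongly convex if $f-\frac\mu2\|\cdot\|^2$ is convex. Rand-$k$ compressor, $k\in[d]$: select a subset of $k$ coordinates of $[d]$ uniformly at random; the selected coordinates of $x$ are multiplied by $d/k$ and the others are set to $0$. It is unbiased and satisfies $\mathbb{E}[\|\mathcal{C}(x)-x\|^2]\le\omega\|x\|^2$ for all $x\in\mathbb{R}^d$, with $\omega=\frac dk-1$. Its output is communicated using $k$ reals. LoCoDL algorithm. Input: stepsizes $\gamma>0$, $\chi>0$, $\rho>0$; probability $p\in(0,1]$; variance factor $\omega\ge 0$; (deterministic) initial vectors $x_1^0,\dots,x_n^0,y^0\in\mathbb{R}^d$ and $u_1^0,\dots,u_n^0,v^0\in\mathbb{R}^d$ with $\frac1n\sum_{i=1}^n u_i^0+v^0=0$. For $t=0,1,2,\dots$: - For each $i\in[n]$, $\hat x_i^t:=x_i^t-\gamma\nabla f_i(x_i^t)+\gamma u_i^t$; and $\hat y^t:=y^t-\gamma\nabla g(y^t)+\gamma v^t$. - Draw a coin $\theta^t\in\{0,1\}$, common to all $i$, with $\mathrm{Prob}(\theta^t=1)=p$. The coin flips are independent of each other and of the compressors. - If $\theta^t=1$ (a communication round): $d_i^t:=\mathcal{C}_i^t(\hat x_i^t-\hat y^t)$ is sent by client $i$ to the server, for each $i\in[n]$;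 $\bar d^t:=\frac1{2n}\sum_{j=1}^n d_j^t$; and $x_i^{t+1}:=(1-\rho)\hat x_i^t+\rho(\hat y^t+\bar d^t)$, $u_i^{t+1}:=u_i^t+\frac{p\chi}{\gamma(1+2\omega)}(\bar d^t-d_i^t)$ for each $i\in[n]$, $y^{t+1}:=\hat y^t+\rho\bar d^t$, $v^{t+1}:=v^t+\frac{p\chi}{\gamma(1+2\omega)}\bar d^t$. - If $\theta^t=0$: $x_i^{t+1}:=\hat x_i^t$, $u_i^{t+1}:=u_i^t$ for each $i\in[n]$, $y^{t+1}:=\hat y^t$, $v^{t+1}:=v^t$. The randomness at iteration $t$ is independent of the past. Expectations are over all coins and compressors. Lyapunov function: with $v^\star:=\nabla g(x^\star)$ and $u_i^\star:=\nabla f_i(x^\star)$, $$\Psi^t:=\frac1\gamma\left(\sum_{i=1}^n\|x_i^t-x^\star\|^2+n\|y^t-x^\star\|^2\right)+\frac{\gamma(1+2\omega)}{p^2\chi}\left(\sum_{i=1}^n\|u_i^t-u_i^\star\|^2+n\|v^t-v^\star\|^2\right).$$ Complexity: the iteration complexity to reach $\epsilon$-accuracy is the number $T$ of iterations after which $\mathbb{E}[\Psi^t]\le\epsilon\Psi^0$ (i.e. the smallest $T$ such that this holds for all $t\ge T$). The communication complexity in number of rounds is $p$ times the iteration complexity (the expected number of communication rounds), and the uplink communication complexity in number of reals is $k$ times the communication complexity in number of rounds (the expected number of reals sent by each client to the server). Asymptotic notation: $\gamma=\Theta(1/L)$ means $c_1/L\le\gamma\le c_2/L$ for fixed constants $0<c_1\le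 c_2<2$; the constant hidden in $\mathcal{O}(\cdot)$ depends only on $c_1,c_2$, uniformly over $d,n,L,\mu$, the functions, the initial vectors and $\epsilon\in(0,1/2]$. *)

(* Defs.v *)
From HB Require Import structures.
From mathcomp Require Import all_boot all_order all_algebra.
From mathcomp Require Import all_classical all_reals all_analysis.
Set Implicit Arguments.
Unset Strict Implicit.
Unset Printing Implicit Defensive.
Import Order.TTheory GRing.Theory Num.Theory.
Import numFieldNormedType.Exports.
Local Open Scope classical_set_scope.
Local Open Scope ring_scope.

(* The library's norm on 'rV[R]_d is the sup norm, hence this definition.
   Differentiability does not depend on the choice of the norm. *)
Definition enorm (R : realType) (d : nat) (x : 'rV[R]_d) : R :=
  Num.sqrt (\sum_(j < d) x ord0 j ^+ 2).

Definition gradient (R : realType) (d : nat) (f : 'rV[R]_d -> R)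
    (x : 'rV[R]_d) : 'rV[R]_d :=
  \row_(j < d) 'D_(delta_mx ord0 j) f x.

Definition smooth (R : realType) (d : nat) (L : R) (f : 'rV[R]_d -> R) : Prop :=
  forall x y : 'rV[R]_d,
    enorm (gradient f x - gradient f y) <= L * enorm (x - y).

Definition strongly_convex (R : realType) (d : nat) (mu : R)
    (f : 'rV[R]_d -> R) : Prop :=
  @convex_function R 'rV[R]_d setT (fun x => f x - mu / 2 * enorm x ^+ 2).

Definition minimizer (T : Type) (R : realType) (F : T -> R) (x : T) : Prop :=
  forall y : T, F x <= F y.

Definition randk (R : realType) (d k : nat) (S : {set 'I_d}) (x : 'rV[R]_d) :
    'rV[R]_d :=
  \row_(j < d) (if j \in S then d%:R / k%:R * x ord0 j else 0).

Record locodl_state (R : realType) (n d : nat) := LocodlState {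
  st_x : 'I_n -> 'rV[R]_d;
  st_u : 'I_n -> 'rV[R]_d;
  st_y : 'rV[R]_d;
  st_v : 'rV[R]_d }.

(* [coin] is the value of theta^t and [C i] the realized map C_i^t. *)
Definition locodl_step (R : realType) (n d : nat)
    (f : 'I_n -> 'rV[R]_d -> R) (g : 'rV[R]_d -> R)
    (gamma chi rho p omega : R) (coin : bool)
    (C : 'I_n -> 'rV[R]_d -> 'rV[R]_d) (s : locodl_state R n d) :
    locodl_state R n d :=
  let xhat i := st_x s i - gamma *: gradient (f i) (st_x s i)
                + gamma *: st_u s i in
  let yhat := st_y s - gamma *: gradient g (st_y s) + gamma *: st_v s in
  let delta i := C i (xhat i - yhat) in
  let dbar := (2 * n%:R)^-1 *: \sum_(j < n) delta j in
  let eta := p * chi / (gamma * (1 + 2 * omega)) in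
  if coin then
    {| st_x := fun i => (1 - rho) *: xhat i + rho *: (yhat + dbar);
       st_u := fun i => st_u s i + eta *: (dbar - delta i);
       st_y := yhat + rho *: dbar;
       st_v := st_v s + eta *: dbar |}
  else
    {| st_x := xhat; st_u := st_u s; st_y := yhat; st_v := st_v s |}.

Fixpoint locodl (R : realType) (n d : nat)
    (f : 'I_n -> 'rV[R]_d -> R) (g : 'rV[R]_d -> R)
    (gamma chi rho p omega : R) (coin : nat -> bool)
    (C : nat -> 'I_n -> 'rV[R]_d -> 'rV[R]_d) (s0 : locodl_state R n d)
    (t : nat) : locodl_state R n d :=
  if t is t'.+1 then
    locodl_step f g gamma chi rho p omega (coin t') (C t')
      (locodl f g gamma chi rho p omega coin C s0 t')
  else s0.

Definition lyapunov (R : realType) (n d : nat)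
    (f : 'I_n -> 'rV[R]_d -> R) (g : 'rV[R]_d -> R)
    (gamma chi p omega : R) (xstar : 'rV[R]_d) (s : locodl_state R n d) : R :=
  gamma^-1 * (\sum_(i < n) enorm (st_x s i - xstar) ^+ 2
              + n%:R * enorm (st_y s - xstar) ^+ 2)
  + gamma * (1 + 2 * omega) / (p ^+ 2 * chi)
    * (\sum_(i < n) enorm (st_u s i - gradient (f i) xstar) ^+ 2
       + n%:R * enorm (st_v s - gradient g xstar) ^+ 2).

Definition bernoulli_coin (disp : measure_display) (Omega : measurableType disp)
    (R : realType) (P : probability Omega R) (p : R) (theta : Omega -> bool) :
    Prop :=
  measurable_fun setT theta /\ P (theta @^-1` [set true]) = p%:E.

Definition uniform_subset (disp : measure_display)
    (Omega : measurableType disp) (R : realType) (P : probability Omega R)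
    (d k : nat) (S : Omega -> {set 'I_d}) : Prop :=
  forall A : {set 'I_d}, measurable (S @^-1` [set A]) /\
    P (S @^-1` [set A]) = (if #|A| == k then 'C(d, k)%:R^-1 else 0)%:E.

Definition mutually_independent (disp : measure_display)
    (Omega : measurableType disp) (R : realType) (P : probability Omega R)
    (I : choiceType) (E : I -> set (set Omega)) : Prop :=
  forall (s : seq I) (A : I -> set Omega), uniq s ->
    (forall i, i \in s -> E i (A i)) ->
    P (\bigcap_(i in [set` s]) A i) = (\prod_(i <- s) P (A i))%E.

(* The sigma-algebra generated by a random variable with values in a finite
   set, which carries the sigma-algebra of all its subsets. *)
Definition events_of (Omega F : Type) (X : Omega -> F) : set (set Omega) :=
  preimage_set_system setT X setT.

(* All sources of randomness, as one family: [inl t] is the coin of iteration t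
   and [inr (t, i)] the coordinate subset of client i at iteration t. *)
Definition locodl_events (Omega : Type) (n d : nat) (theta : nat -> Omega -> bool)
    (S : nat -> 'I_n -> Omega -> {set 'I_d}) (j : nat + nat * 'I_n) :
    set (set Omega) :=
  match j with
  | inl t => events_of (theta t)
  | inr (t, i) => events_of (S t i)
  end.

Definition accurate_after (disp : measure_display)
    (Omega : measurableType disp) (R : realType) (P : probability Omega R)
    (Psi : nat -> Omega -> R) (Psi0 eps : R) (T : nat) : Prop :=
  forall t : nat, (T <= t)%N -> ('E_P[Psi t] <= (eps * Psi0)%:E)%E.

Definition iteration_complexity (disp : measure_display)
    (Omega : measurableType disp) (R : realType) (P : probability Omega R)
    (Psi : nat -> Omega -> R) (Psi0 eps : R) (T : nat) : Prop :=
  accurate_after P Psi Psi0 eps T /\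
  forall T' : nat, accurate_after P Psi Psi0 eps T' -> (T <= T')%N.

Definition communication_rounds (R : realType) (p : R) (T : nat) : R :=
  p * T%:R.

Definition uplink_reals (R : realType) (k : nat) (p : R) (T : nat) : R :=
  k%:R * communication_rounds p T.

(* Main.v *)
Require Import Defs.
From HB Require Import structures.
From mathcomp Require Import all_boot all_order all_algebra.
From mathcomp Require Import all_classical all_reals all_analysis.
From mathcomp Require Import measurable_realfun ring lra.
Set Implicit Arguments.
Unset Strict Implicit.
Unset Printing Implicit Defensive.
Import Order.TTheory GRing.Theory Num.Theory.
Import numFieldNormedType.Exports.
Local Open Scope classical_set_scope.
Local Open Scope ring_scope.

(** The proof is that of a linear rate for the Lyapunov function, followed by
    a count of the reals that are sent.

    Rate. Write X_i and Y for the errors of the half-steps (xhat_i and yhat,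
    minus xstar) and U_i, V for the errors of the control vectors. The updates
    keep sum u_i + n v = 0, and optimality of xstar gives the same relation for
    the gradients at xstar, so (U, V) is orthogonal to the consensus space. When
    a communication round happens, the x-part decreases in expectation by
    (chi / gamma) D, where D is the squared distance of (X, Y) to consensus; the
    u-part changes by a cross term -2 <U, X> / p and increases by a multiple of
    D. The parameters are tuned so that the two multiples of D cancel exactly,
    and completing
    the square leaves
      |X - gamma U|^2 / gamma + (c - gamma) |U|^2,
    c being the weight of the u-part ([one_round_coordinate]). Here X - gamma U
    is a difference of two gradient steps with the control vectors gone, so
    smoothness and strong convexity shrink it ([gradient_step_contracts]), while
    c - gamma = c (1 - p^2 chi / (1 + 2 omega)). This gives a one-step factor
    1 - delta ([expected_lyapunov_step]). Everything in the random part is a sum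
    over coordinates, and for one coordinate rand-k is multiplication by a
    random scalar of mean 1 and second moment 1 + omega, independent between
    clients; only these moments matter.

    From one step to t steps. The state after t iterations is a function of
    the first t outcomes (coin and subsets), which take finitely many values
    and, by independence, have a product law ([outcome_law]). The expectation is
    thus an iterated finite sum ([expectation_history]), to which the one-step
    bound applies t times ([expected_lyapunov_decay]).

    Complexity. With w = d / k in [1, n], one has p^2 = min(w / (chi kappa), 1)
    and chi >= 1/2, so that delta can be taken of order 1 / (kappa + d / k)
    ([sqr_coin_rate]); O((kappa + d / k) log(1/eps)) iterations suffice. The
    number of reals per unit of log(1/eps) is then of order
    k p (kappa + d / k) <= k p kappa + d, and the first summand is at most
    sqrt(kappa (d k + d^2 / n)), where k <= d / n + 1
    ([uplink_per_contraction]). *)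

(** * Euclidean geometry and gradients *)

Definition dot (R : realType) (d : nat) (x y : 'rV[R]_d) : R :=
  \sum_(j < d) x ord0 j * y ord0 j.

Lemma sqr_enorm (R : realType) (d : nat) (x : 'rV[R]_d) :
  enorm x ^+ 2 = dot x x.
Proof.
rewrite /enorm sqr_sqrtr; last by apply: sumr_ge0 => j _; exact: sqr_ge0.
by apply: eq_bigr => j _; rewrite expr2.
Qed.

Lemma dot_ge0 (R : realType) (d : nat) (x : 'rV[R]_d) : 0 <= dot x x.
Proof. by rewrite -sqr_enorm sqr_ge0. Qed.

Lemma dotC (R : realType) (d : nat) (x y : 'rV[R]_d) : dot x y = dot y x.
Proof. by apply: eq_bigr => j _; rewrite mulrC. Qed.

Lemma dotDl (R : realType) (d : nat) (x y z : 'rV[R]_d) :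
  dot (x + y) z = dot x z + dot y z.
Proof. by rewrite -big_split; apply: eq_bigr => j _; rewrite !mxE mulrDl. Qed.

Lemma dotZl (R : realType) (d : nat) (a : R) (x y : 'rV[R]_d) :
  dot (a *: x) y = a * dot x y.
Proof. by rewrite mulr_sumr; apply: eq_bigr => j _; rewrite !mxE mulrA. Qed.

Lemma dotNl (R : realType) (d : nat) (x y : 'rV[R]_d) :
  dot (- x) y = - dot x y.
Proof. by rewrite -scaleN1r dotZl mulN1r. Qed.

Lemma dotDr (R : realType) (d : nat) (x y z : 'rV[R]_d) :
  dot z (x + y) = dot z x + dot z y.
Proof. by rewrite dotC dotDl !(dotC z). Qed.

Lemma dotZr (R : realType) (d : nat) (a : R) (x y : 'rV[R]_d) :
  dot x (a *: y) = a * dot x y.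
Proof. by rewrite dotC dotZl dotC. Qed.

Lemma dotNr (R : realType) (d : nat) (x y : 'rV[R]_d) :
  dot x (- y) = - dot x y.
Proof. by rewrite dotC dotNl dotC. Qed.

Definition dotE := (dotDl, dotDr, dotNl, dotNr, dotZl, dotZr).

Lemma dot_eq0 (R : realType) (d : nat) (x : 'rV[R]_d) : dot x x <= 0 -> x = 0.
Proof.
move=> x0; have /eqP : dot x x = 0 by apply/le_anti; rewrite x0 dot_ge0.
rewrite psumr_eq0 => [/allP h|j _]; last by rewrite -expr2 sqr_ge0.
apply/rowP => j; rewrite mxE; apply/eqP.
by have := h j (mem_index_enum _); rewrite -expr2 sqrf_eq0.
Qed.

(** The form in which a Lipschitz bound on gradients is used: Cauchy-Schwarz,
    obtained from the squares of a - s b and a + s b instead of square roots. *)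
Lemma dot_le (R : realType) (d : nat) (s : R) (a b : 'rV[R]_d) :
  0 <= s -> dot a a <= s ^+ 2 * dot b b -> `|dot a b| <= s * dot b b.
Proof.
rewrite le_eqVlt => /predU1P[<-|s0] ab.
  rewrite expr0n/= mul0r in ab.
  rewrite (dot_eq0 ab) mul0r /dot big1 ?normr0// => j _.
  by rewrite mxE mul0r.
have h1 := dot_ge0 (a - s *: b); have h2 := dot_ge0 (a + s *: b).
rewrite !dotE (dotC b a) in h1 h2.
have {}h1 : s * dot a b <= s * (s * dot b b) by nra.
have {}h2 : s * - dot a b <= s * (s * dot b b) by nra.
by rewrite ler_norml lerNl; rewrite !ler_pM2l// in h1 h2; rewrite h1 h2.
Qed.

Lemma deriveE_dot (R : realType) (d : nat) (f : 'rV[R]_d -> R)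
    (x v : 'rV[R]_d) :
  differentiable f x -> 'D_v f x = dot (gradient f x) v.
Proof.
move=> df; rewrite deriveE// {1}(row_sum_delta v) linear_sum /=.
apply: eq_bigr => j _; rewrite linearZ/= mxE deriveE//.
by rewrite mulrC.
Qed.

(** Restricting to lines reduces the calculus below to one variable. *)
Lemma is_derive_line (R : realType) (d : nat) (f : 'rV[R]_d -> R)
    (x r : 'rV[R]_d) (t : R) :
  (forall z, differentiable f z) ->
  is_derive t 1 (fun s : R => f (x + s *: r))
    (dot (gradient f (x + t *: r)) r).
Proof.
move=> df; rewrite -deriveE_dot//.
have dl : is_diff t (fun s : R => x + s *: r) (fun s : R => 0 + s *: r).
  by apply: is_diffD.
have dd : differentiable (fun s : R => x + s *: r) t by exact: ex_diff.
have dc := differentiable_comp dd (df (x + t *: r)).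
rewrite [X in is_derive _ _ X](_ : _ = f \o (fun s : R => x + s *: r))//.
apply: DeriveDef; first exact: diff_derivable.
rewrite deriveE// diff_comp//= diff_val /= add0r scale1r.
by rewrite deriveE.
Qed.

(** * Smooth and strongly convex functions *)

Lemma smooth_dot (R : realType) (d : nat) (L : R) (f : 'rV[R]_d -> R) :
  0 <= L -> smooth L f -> forall x y : 'rV[R]_d,
  dot (gradient f x - gradient f y) (gradient f x - gradient f y)
  <= L ^+ 2 * dot (x - y) (x - y).
Proof.
move=> L0 fL x y; rewrite -!sqr_enorm -exprMn lerXn2r ?fL// nnegrE.
- exact: sqrtr_ge0.
- by rewrite mulr_ge0// sqrtr_ge0.
Qed.

(** The mean value theorem for s |-> f (x + s r) - K s^2. The quadratic
    correction is what yields the sharp constant L / 2, rather than L, in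
    [smooth_descent]; that constant is needed for cocoercivity. *)
Lemma mean_value_line (R : realType) (d : nat) (f : 'rV[R]_d -> R) (K : R)
    (x r : 'rV[R]_d) :
  (forall z, differentiable f z) ->
  exists2 c : R, 0 < c < 1 &
    f (x + r) - f x = dot (gradient f (x + c *: r)) r + K * (1 - 2 * c).
Proof.
move=> df.
pose F (s : R) := f (x + s *: r) - K * s ^+ 2.
pose F' (s : R) := dot (gradient f (x + s *: r)) r - K * (2 * s).
have dF (s : R) : is_derive s 1 F (F' s).
  have d1 := is_derive_line x r s df.
  have d2 : is_derive s (1 : R) (fun s : R => K * s ^+ 2) (K * (2 * s)).
    apply: is_derive_eq.
    rewrite /GRing.scale/=; ring.
  exact: is_deriveB.
have cF : {within `[0, 1], continuous F}.
  apply: continuous_subspaceT => s.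
  apply: differentiable_continuous; apply/derivable1_diffP.
  exact: ex_derive.
have [c c01 E] := MVT ltr01 (fun s _ => dF s) cF.
exists c; first by move: c01; rewrite in_itv.
move: E; rewrite /F /F' scale1r scale0r addr0; lra.
Qed.

Lemma smooth_descent (R : realType) (d : nat) (L : R) (f : 'rV[R]_d -> R) :
  0 <= L -> (forall z, differentiable f z) -> smooth L f ->
  forall x r : 'rV[R]_d,
  `|f (x + r) - f x - dot (gradient f x) r| <= L / 2 * dot r r.
Proof.
move=> L0 df fL x r.
have key (c : R) : 0 < c < 1 ->
    `|dot (gradient f (x + c *: r)) r - dot (gradient f x) r|
    <= L * c * dot r r.
  case/andP => c0 _; rewrite -dotNl -dotDl; apply: dot_le.
    by rewrite mulr_ge0// ltW.
  apply: le_trans (smooth_dot L0 fL _ _) _.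
  by rewrite addrAC subrr add0r !dotE; lra.
have [c /key] := mean_value_line (L / 2 * dot r r) x r df.
have [e /key] := mean_value_line (- (L / 2 * dot r r)) x r df.
rewrite !ler_norml; lra.
Qed.

Lemma strongly_convexE (R : realType) (d : nat) (mu : R) (f : 'rV[R]_d -> R) :
  strongly_convex mu f -> forall (x r : 'rV[R]_d) (t : R), 0 <= t <= 1 ->
  f (x + t *: r) <= (1 - t) * f x + t * f (x + r)
                    - mu / 2 * t * (1 - t) * dot r r.
Proof.
move=> fc x r t /andP[t0 t1].
have cE : (@conv _ (convex_lmodType 'rV[R]_d) (Itv01 t0 t1) (x + r) x : 'rV[R]_d)
    = x + t *: r.
  change (t *: (x + r) + (1 - t) *: x = x + t *: r).
  by rewrite scalerBl scale1r scalerDr addrCA addrAC subrr add0r.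
have := fc (Itv01 t0 t1) (x + r) x (mem_set I) (mem_set I).
rewrite cE /= (sqr_enorm (x + t *: r)).
set c := (X in _ <= X).
have -> : c = t * (f (x + r) - mu / 2 * dot (x + r) (x + r))
    + (1 - t) * (f x - mu / 2 * dot x x).
  by rewrite -!(sqr_enorm x) -(sqr_enorm (x + r)).
rewrite !dotE (dotC r x).
lra.
Qed.

(** Divide the convexity inequality at x + t r by t and let t tend to 0, the
    lower bound on f (x + t r) being that of [smooth_descent]. The passage to
    the limit is the remark that A <= t B for all t in (0, 1] forces A <= 0. *)
Lemma strong_convexity_gradient (R : realType) (d : nat) (L mu : R)
    (f : 'rV[R]_d -> R) :
  0 <= L -> (forall z, differentiable f z) ->
  smooth L f -> strongly_convex mu f -> forall x r : 'rV[R]_d,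
  f x + dot (gradient f x) r + mu / 2 * dot r r <= f (x + r).
Proof.
move=> L0 df fL fc x r.
set A := dot (gradient f x) r + mu / 2 * dot r r - (f (x + r) - f x).
set B := (L + mu) / 2 * dot r r.
suff : A <= 0 by rewrite /A; lra.
have key (t : R) : 0 < t <= 1 -> A <= t * B.
  move=> /andP[t0 t1]; rewrite -(ler_pM2l t0).
  have t01 : 0 <= t <= 1 by rewrite ltW.
  have := strongly_convexE fc x r t01.
  have := smooth_descent L0 df fL x (t *: r).
  by rewrite !dotE ler_norml /A /B; lra.
clearbody A B; rewrite leNgt; apply/negP => A0.
have AB : A <= B by rewrite -[B]mul1r; apply: key; rewrite ltr01 lexx.
have B0 : 0 < B by apply: lt_le_trans AB.
have := key (A / (2 * B)).
have -> : A / (2 * B) * B = A / 2 by field; lra.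
have : 0 < A / (2 * B) by rewrite divr_gt0// mulr_gt0.
have : A / (2 * B) <= 1.
  rewrite ler_pdivrMr ?mul1r ?mulr_gt0//; lra.
move=> -> ->; move=> /(_ isT); lra.
Qed.

(** The gradient difference D lies between mu and L times x - y in the strong
    sense (D - mu r) . (L r - D) >= 0 with r = x - y. This is the cocoercivity
    of the gradient of h = f - mu / 2 |.|^2, which is convex and has a quadratic
    upper bound of constant L - mu. *)
Lemma cocoercive (R : realType) (d : nat) (L mu : R) (f : 'rV[R]_d -> R) :
  0 <= L -> mu <= L -> (forall z, differentiable f z) ->
  smooth L f -> strongly_convex mu f -> forall x y : 'rV[R]_d,
  dot (gradient f x - gradient f y) (gradient f x - gradient f y)
  <= (L + mu) * dot (gradient f x - gradient f y) (x - y)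
     - mu * L * dot (x - y) (x - y).
Proof.
move=> L0 muL df fL fc x y; set D := _ - gradient f y; set r := x - y.
pose G := D - mu *: r.
(* Compare, at the point a + w, the tangent plane of h at b with the quadratic
   upper bound of h at a; below, w = -+ s G with s = 1 / (L - mu) is optimal. *)
have key (a b w : 'rV[R]_d) :
    f b - f a - mu / 2 * (dot b b - dot a a)
    + dot (gradient f b - mu *: b) (a - b)
    <= dot ((gradient f a - mu *: a) - (gradient f b - mu *: b)) w
       + (L - mu) / 2 * dot w w.
  have := strong_convexity_gradient L0 df fL fc b (a + w - b).
  have := smooth_descent L0 df fL a w.
  rewrite (addrC b) subrK ler_norml !dotE.
  rewrite !(dotC a) !(dotC b) !(dotC w).
  lra.
have sG (s : R) : 2 * s * dot G G - (L - mu) * s ^+ 2 * dot G G <= dot G r.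
  have := key x y (- s *: G); have := key y x (s *: G).
  rewrite /G /D /r !dotE !(dotC y x).
  set gx := gradient f x; set gy := gradient f y.
  rewrite !(dotC gx) !(dotC gy) !(dotC x) !(dotC y).
  nra.
have : dot G G <= (L - mu) * dot G r.
  have := sG; have := dot_ge0 G.
  set q := dot G G; set m := dot G r => q0 qm.
  have [Lmu|Lmu] := eqVneq L mu.
    (* Then h is affine: sG holds with s arbitrarily large, so G = 0. *)
    rewrite Lmu subrr mul0r leNgt; apply/negP => qp.
    have := qm ((m + 1) / (2 * q)).
    have -> : 2 * ((m + 1) / (2 * q)) * q = m + 1 by field; lra.
    rewrite Lmu subrr !mul0r; lra.
  have M0 : 0 < L - mu by rewrite subr_gt0 lt_neqAle eq_sym Lmu.
  rewrite mulrC -ler_pdivrMr//.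
  have := qm (L - mu)^-1.
  have -> : 2 * (L - mu)^-1 * q - (L - mu) * (L - mu)^-1 ^+ 2 * q = q / (L - mu).
    by field; lra.
  by [].
rewrite /G; clear sG; clearbody D r; rewrite !dotE (dotC r D); lra.
Qed.

(** By cocoercivity |r - gamma D|^2 is at most an affine function of
    D . r, which ranges between mu |r|^2 and L |r|^2; at the two ends the bound
    equals (1 - gamma mu)^2 |r|^2 and (1 - gamma L)^2 |r|^2. *)
Lemma gradient_step_contracts (R : realType) (d : nat)
    (L mu gamma delta : R) (f : 'rV[R]_d -> R) :
  0 < mu -> mu <= L -> 0 < gamma -> 
  delta <= gamma * mu * (2 - gamma * mu) ->
  delta <= gamma * L * (2 - gamma * L) ->
  (forall z, differentiable f z) ->
  smooth L f -> strongly_convex mu f -> forall x y : 'rV[R]_d,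
  enorm (x - gamma *: gradient f x - (y - gamma *: gradient f y)) ^+ 2
  <= (1 - delta) * enorm (x - y) ^+ 2.
Proof.
move=> mu0 muL g0 dmu dL df fL fc x y; rewrite !sqr_enorm; set r := _ - (y - _).
have L0 : 0 <= L by lra.
pose D := gradient f x - gradient f y.
have -> : r = (x - y) - gamma *: D.
  by apply/rowP => j; rewrite !mxE; ring.
have coco := cocoercive L0 muL df fL fc x y; rewrite -/D in coco.
have DL : dot D (x - y) <= L * dot (x - y) (x - y).
  apply: le_trans (ler_norm _) _; apply: dot_le => //.
  exact: smooth_dot.
have Dmu : mu * dot (x - y) (x - y) <= dot D (x - y).
  have := strong_convexity_gradient L0 df fL fc x (y - x).
  have := strong_convexity_gradient L0 df fL fc y (x - y).
  rewrite !(addrC _ (_ - _)) !subrK.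
  have -> : y - x = - (x - y) by rewrite opprB.
  rewrite /D !(dotNl, dotNr, dotDl); lra.
have := dot_ge0 (x - y).
clear r; move: (x - y) D coco DL Dmu => r D.
rewrite dotDr !dotDl !(dotNl, dotNr) !(dotZl, dotZr) (dotC r D).
set q := dot r r; set m := dot D r; set e := dot D D => coco DL Dmu q0.
clearbody q m e.
have h1 : gamma ^+ 2 * e <= gamma ^+ 2 * ((L + mu) * m - mu * L * q).
  by rewrite ler_wpM2l// sqr_ge0.
have h2 : delta * q <= gamma * mu * (2 - gamma * mu) * q by rewrite ler_wpM2r.
have h3 : delta * q <= gamma * L * (2 - gamma * L) * q by rewrite ler_wpM2r.
have [s0|s0] := lerP 0 (2 - gamma * (L + mu)).
  have := mulr_ge0 (mulr_ge0 (ltW g0) s0) (_ : 0 <= m - mu * q).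
  rewrite subr_ge0 => /(_ Dmu); lra.
have s1 : 0 <= gamma * (L + mu) - 2 by lra.
have := mulr_ge0 (mulr_ge0 (ltW g0) s1) (_ : 0 <= L * q - m).
rewrite subr_ge0 => /(_ DL); lra.
Qed.

Lemma dot_suml (R : realType) (d n : nat) (F : 'I_n -> 'rV[R]_d) (x : 'rV[R]_d) :
  dot (\sum_(i < n) F i) x = \sum_(i < n) dot (F i) x.
Proof.
rewrite /dot exchange_big/=; apply: eq_bigr => j _.
by rewrite summxE mulr_suml.
Qed.

(** If the gradient G of the objective did not vanish, a short step along - G
    would decrease the objective, by the quadratic upper bound. *)
Lemma minimizer_gradient (R : realType) (d n : nat) (L : R)
    (f : 'I_n -> 'rV[R]_d -> R) (g : 'rV[R]_d -> R) (xs : 'rV[R]_d) :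
  (0 < n)%N -> 0 < L ->
  (forall i z, differentiable (f i) z) -> (forall i, smooth L (f i)) ->
  (forall z, differentiable g z) -> smooth L g ->
  minimizer (fun x => n%:R^-1 * (\sum_(i < n) f i x) + g x) xs ->
  \sum_(i < n) gradient (f i) xs + n%:R *: gradient g xs = 0.
Proof.
move=> n0 L0 df fL dg gL xmin.
have nR0 : n%:R != 0 :> R by rewrite pnatr_eq0 -lt0n.
pose G := n%:R^-1 *: (\sum_(i < n) gradient (f i) xs) + gradient g xs.
suff G0 : G = 0.
  have /(congr1 (fun v => n%:R *: v)) := G0.
  by rewrite /G scalerDr scalerA divff// scale1r scaler0.
(* The objective is 2 L-smooth, whence the step 1 / (2 L). *)
pose r := - (2 * L)^-1 *: G.
have fr i : f i (xs + r) <= f i xs + dot (gradient (f i) xs) r + L / 2 * dot r r.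
  by have := smooth_descent (ltW L0) (df i) (fL i) xs r; rewrite ler_norml; lra.
have gr : g (xs + r) <= g xs + dot (gradient g xs) r + L / 2 * dot r r.
  by have := smooth_descent (ltW L0) dg gL xs r; rewrite ler_norml; lra.
have fsum : n%:R^-1 * (\sum_(i < n) f i (xs + r)) <=
    n%:R^-1 * (\sum_(i < n) f i xs)
    + n%:R^-1 * dot (\sum_(i < n) gradient (f i) xs) r + L / 2 * dot r r.
  rewrite dot_suml -[L / 2 * _](mulKf nR0) -!mulrDr.
  rewrite ler_wpM2l ?invr_ge0 ?ler0n//.
  rewrite mulr_natl -[X in _ *+ X]card_ord -sumr_const -!big_split/=.
  exact: ler_sum.
have := xmin (xs + r); move: fsum gr => /= fsum gr hmin.
have : 0 <= dot G r + L * dot r r.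
  rewrite {1}/G dotDl dotZl; lra.
rewrite /r; move: G {r fr gr fsum hmin} => G; rewrite !dotE => h; apply: dot_eq0.
move: h.
rewrite (_ : _ + _ = - ((4 * L)^-1 * dot G G)); last by field; lra.
by rewrite oppr_ge0 pmulr_rle0// invr_gt0 mulr_gt0.
Qed.

(** * One communication round at one coordinate *)

Lemma sqr_sum_le (R : realType) (n : nat) (a : 'I_n -> R) :
  (\sum_i a i) ^+ 2 <= n%:R * \sum_i a i ^+ 2.
Proof.
case: n a => [|n] a; first by rewrite big_ord0 expr0n mul0r.
set s := \sum_i a i; set N := n.+1%:R : R.
have N0 : 0 < N by rewrite ltr0n.
have : 0 <= \sum_i (a i - s / N) ^+ 2.
  by apply: sumr_ge0 => i _; rewrite sqr_ge0.
have -> : \sum_i (a i - s / N) ^+ 2 = \sum_i a i ^+ 2 - s ^+ 2 / N.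
  under eq_bigr do rewrite sqrrB.
  rewrite big_split/= sumrB sumr_const card_ord -mulr_natl -/N.
  rewrite sumrMnl -mulr_suml -/s.
  by field; lra.
by rewrite subr_ge0 ler_pdivrMr// mulrC.
Qed.

(** In the next three lemmas [w] stands for a probability weight on a finite set
    and [m i] for the random factor by which the compressor of client i
    multiplies a given coordinate. *)
Lemma expect_sum (R : realType) (T : finType) (w : T -> R) (n : nat)
    (m : 'I_n -> T -> R) (a : 'I_n -> R) :
  (forall i, \sum_t w t * m i t = 1) ->
  \sum_t w t * (\sum_i m i t * a i) = \sum_i a i.
Proof.
move=> m1; under eq_bigr do rewrite mulr_sumr.
rewrite exchange_big/=; apply: eq_bigr => i _.
by under eq_bigr do rewrite mulrA; rewrite -mulr_suml m1 mul1r.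
Qed.

(** Independence between clients: the variance of the aggregated message is the
    sum of the variances, not n times it. This is where the gain of a factor n
    comes from. *)
Lemma expect_sum_sqr (R : realType) (T : finType) (w : T -> R) (n : nat)
    (omega : R) (m : 'I_n -> T -> R) (a : 'I_n -> R) :
  (forall i, \sum_t w t * m i t ^+ 2 = 1 + omega) ->
  (forall i j, i != j -> \sum_t w t * (m i t * m j t) = 1) ->
  \sum_t w t * (\sum_i m i t * a i) ^+ 2
  = (\sum_i a i) ^+ 2 + omega * \sum_i a i ^+ 2.
Proof.
move=> m2 m11.
have -> : \sum_t w t * (\sum_i m i t * a i) ^+ 2 =
    \sum_i \sum_j (\sum_t w t * (m i t * m j t)) * (a i * a j).
  under eq_bigr => t _.
    rewrite expr2 big_distrlr/= mulr_sumr.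
    under eq_bigr do rewrite mulr_sumr.
    over.
  rewrite exchange_big/=; apply: eq_bigr => i _.
  rewrite exchange_big/=; apply: eq_bigr => j _.
  by rewrite mulr_suml; apply: eq_bigr => t _; ring.
rewrite [in RHS]expr2 big_distrlr/= mulr_sumr -big_split/=.
apply: eq_bigr => i _; rewrite (bigD1 i)//= [in RHS](bigD1 i)//=.
have -> : \sum_(j < n | j != i) (\sum_t w t * (m i t * m j t)) * (a i * a j)
    = \sum_(j < n | j != i) a i * a j.
  by apply: eq_bigr => j ji; rewrite m11 ?mul1r// eq_sym.
under [\sum_t _]eq_bigr do rewrite -expr2.
by rewrite m2; ring.
Qed.

(** One iteration of the algorithm seen at one coordinate, in variables centred
    at the solution. The proof expands the round as a polynomial in the sums
    S = sum m_i a_i, sum m_i^2 a_i^2 and sum m_i U_i a_i, whose expectations are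
    known. With D = sum a_i^2 - (sum a_i)^2 / (2 n), the squared distance of
    (X, Y) to consensus in the norm giving weight n to Y, the x-part becomes at
    most X2 - chi D and the u-part at most
    W2 - 2 eta (UX + n V Y) + eta^2 (1 + 2 omega) D; the choice of [eta] and [c]
    gives p c eta = 1 and c eta^2 (1 + 2 omega) = chi / gamma, so D disappears
    and a square can be completed. *)
Lemma one_round_coordinate (R : realType) (T : finType) (w : T -> R) (n : nat)
    (m : 'I_n -> T -> R) (X U : 'I_n -> R) (Y V gamma chi p omega : R) :
  (0 < n)%N -> 0 < gamma -> 0 < p -> 0 <= omega ->
  chi = n%:R / (n%:R + omega) ->
  \sum_t w t = 1 ->
  (forall i, \sum_t w t * m i t = 1) ->
  (forall i, \sum_t w t * m i t ^+ 2 = 1 + omega) ->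
  (forall i j, i != j -> \sum_t w t * (m i t * m j t) = 1) ->
  \sum_i U i + n%:R * V = 0 ->
  let a i := X i - Y in
  let dbar t := (2 * n%:R)^-1 * \sum_i m i t * a i in
  let eta := p * chi / (gamma * (1 + 2 * omega)) in
  let c := gamma * (1 + 2 * omega) / (p ^+ 2 * chi) in
  let after t :=
    gamma^-1 * (\sum_i ((1 - chi) * X i + chi * (Y + dbar t)) ^+ 2
                + n%:R * (Y + chi * dbar t) ^+ 2)
    + c * (\sum_i (U i + eta * (dbar t - m i t * a i)) ^+ 2
           + n%:R * (V + eta * dbar t) ^+ 2) in
  let skipped :=
    gamma^-1 * (\sum_i X i ^+ 2 + n%:R * Y ^+ 2)
    + c * (\sum_i U i ^+ 2 + n%:R * V ^+ 2) in
  is_true (p * (\sum_t w t * after t) + (1 - p) * skipped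
    <= gamma^-1 * (\sum_i (X i - gamma * U i) ^+ 2
                   + n%:R * (Y - gamma * V) ^+ 2)
       + (c - gamma) * (\sum_i U i ^+ 2 + n%:R * V ^+ 2)).
Proof.
move=> n0 g0 p0 o0 chiE w1 m1 m2 m11 UV a dbar eta c after skipped.
set N := n%:R : R in chiE UV dbar after skipped *.
have N0 : 0 < N by rewrite ltr0n.
have chi0 : 0 < chi by rewrite chiE divr_gt0//; lra.
pose S t := \sum_i m i t * a i.
pose s := \sum_i a i; pose q := \sum_i a i ^+ 2.
pose P := \sum_i X i; pose P2 := \sum_i X i ^+ 2.
pose U1 := \sum_i U i; pose U2 := \sum_i U i ^+ 2.
pose UX := \sum_i U i * X i.
have Ncst (k : R) : N * k = \sum_(i < n) k.
  by rewrite sumr_const card_ord -mulr_natl.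
have sE : s = P + N * - Y by rewrite Ncst -big_split.
have qE : q = P2 + (- 2 * Y) * P + N * Y ^+ 2.
  rewrite Ncst mulr_sumr -!big_split/=; apply: eq_bigr => i _.
  by rewrite /a; ring.
have UaE : \sum_i U i * a i = UX + (- Y) * U1.
  rewrite mulr_sumr -big_split; apply: eq_bigr => i _.
  by rewrite /a /=; ring.
(* [x0] collects the terms of the x-part without the random S. *)
pose x0 := \sum_i ((1 - chi) * X i + chi * Y) ^+ 2 + N * Y ^+ 2.
have x0E : x0 = (1 - chi) ^+ 2 * P2 + (2 * (1 - chi) * chi * Y) * P
    + N * (chi * Y) ^+ 2 + N * Y ^+ 2.
  congr (_ + _); rewrite Ncst !mulr_sumr -!big_split; apply: eq_bigr => i _ /=.
  by ring.
have xE t : \sum_i ((1 - chi) * X i + chi * (Y + dbar t)) ^+ 2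
      + N * (Y + chi * dbar t) ^+ 2 =
    x0 + chi / N * ((1 - chi) * P + N * chi * Y + N * Y) * S t
    + chi ^+ 2 / (2 * N) * S t ^+ 2.
  transitivity (x0 + 2 * chi * dbar t * ((1 - chi) * P + N * chi * Y + N * Y)
    + 2 * N * chi ^+ 2 * dbar t ^+ 2); last first.
    by rewrite /dbar -/N -/(S t); field; lra.
  rewrite /x0.
  transitivity ((\sum_i ((1 - chi) * X i + chi * Y) ^+ 2
    + (2 * chi * dbar t * (1 - chi)) * P
    + N * (2 * chi * dbar t * chi * Y + chi ^+ 2 * dbar t ^+ 2))
    + N * (Y + chi * dbar t) ^+ 2); last by ring.
  congr (_ + _); rewrite Ncst mulr_sumr -!big_split; apply: eq_bigr => i _ /=.
  by ring.
have uE t : \sum_i (U i + eta * (dbar t - m i t * a i)) ^+ 2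
      + N * (V + eta * dbar t) ^+ 2 =
    U2 + N * V ^+ 2 + - 2 * eta * (\sum_i m i t * (U i * a i))
    + eta ^+ 2 * (\sum_i m i t ^+ 2 * a i ^+ 2 - S t ^+ 2 / (2 * N)).
  transitivity (U2 + N * V ^+ 2 + (2 * eta * dbar t) * (U1 + N * V)
    - 2 * eta * (\sum_i m i t * (U i * a i))
    + eta ^+ 2 * (\sum_i m i t ^+ 2 * a i ^+ 2
                  + 2 * N * dbar t ^+ 2 - 2 * dbar t * S t)); last first.
    by rewrite UV /dbar -/N -/(S t); field; lra.
  transitivity ((U2 + (2 * eta * dbar t) * U1
    + (- 2 * eta) * (\sum_i m i t * (U i * a i))
    + eta ^+ 2 * (\sum_i m i t ^+ 2 * a i ^+ 2)
    + (- 2 * eta ^+ 2 * dbar t) * S t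
    + N * (eta * dbar t) ^+ 2)
    + N * (V + eta * dbar t) ^+ 2); last by ring.
  congr (_ + _); rewrite Ncst !mulr_sumr -!big_split; apply: eq_bigr => i _ /=.
  by ring.
have Ew (k : R) : \sum_t w t * k = k by rewrite -mulr_suml w1 mul1r.
have Eaff (k A B : R) (F G : T -> R) :
    \sum_t w t * (k + A * F t + B * G t) =
    k + A * (\sum_t w t * F t) + B * (\sum_t w t * G t).
  rewrite -[k in RHS]Ew !mulr_sumr -!big_split/=.
  by apply: eq_bigr => t _; ring.
have ES : \sum_t w t * S t = s by exact: expect_sum.
have ES2 : \sum_t w t * S t ^+ 2 = s ^+ 2 + omega * q.
  exact: expect_sum_sqr.
have EU : \sum_t w t * (\sum_i m i t * (U i * a i)) = \sum_i U i * a i.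
  exact: expect_sum.
have Eq : \sum_t w t * (\sum_i m i t ^+ 2 * a i ^+ 2) = (1 + omega) * q.
  under eq_bigr do rewrite mulr_sumr.
  rewrite exchange_big/= mulr_sumr; apply: eq_bigr => i _.
  by under eq_bigr do rewrite mulrA; rewrite -mulr_suml m2.
pose D := q - s ^+ 2 / (2 * N).
have sq : s ^+ 2 <= N * q by exact: sqr_sum_le.
(* The compression noise, proportional to q, is controlled by the distance to
   consensus. *)
have D0 : q <= 2 * D.
  have : s ^+ 2 / N <= q by rewrite ler_pdivrMr// mulrC.
  have -> : 2 * D = 2 * q - s ^+ 2 / N by rewrite /D; field; lra.
  lra.
pose X2 := P2 + N * Y ^+ 2; pose W2 := U2 + N * V ^+ 2.
pose C := UX + N * (V * Y).
have Ex : \sum_t w t * (\sum_i ((1 - chi) * X i + chi * (Y + dbar t)) ^+ 2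
      + N * (Y + chi * dbar t) ^+ 2) <= X2 - chi * D.
  under eq_bigr do rewrite xE.
  rewrite Eaff ES ES2 x0E.
  have -> : P = s + N * Y by rewrite sE; ring.
  have -> : X2 = q + 2 * Y * (s + N * Y) by rewrite qE sE /X2; ring.
  have -> : P2 = q + 2 * Y * (s + N * Y) - N * Y ^+ 2 by rewrite qE sE; ring.
  pose r := chi ^+ 2 * omega / N.
  have h : 0 <= r * (2 * D - q).
    by rewrite mulr_ge0 ?subr_ge0// divr_ge0 ?mulr_ge0 ?sqr_ge0// ltW.
  have chiD : chi * D = chi ^+ 2 * D + r * D.
    by rewrite -mulrDl; congr (_ * _); rewrite /r chiE; field; lra.
  rewrite [leLHS](_ : _ = q + 2 * Y * (s + N * Y) - (2 * chi - chi ^+ 2) * D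
    + r / 2 * q); first by clearbody D r; lra.
  by rewrite /D /r; field; lra.
have Eu : \sum_t w t * (\sum_i (U i + eta * (dbar t - m i t * a i)) ^+ 2
      + N * (V + eta * dbar t) ^+ 2)
    <= W2 - 2 * eta * C + eta ^+ 2 * (1 + 2 * omega) * D.
  under eq_bigr do rewrite uE.
  rewrite Eaff EU UaE.
  have -> : \sum_t w t * (\sum_i m i t ^+ 2 * a i ^+ 2 - S t ^+ 2 / (2 * N)) =
      (1 + omega) * q - (s ^+ 2 + omega * q) / (2 * N).
    rewrite -Eq -ES2 mulr_suml -sumrB; apply: eq_bigr => t _.
    by rewrite mulrBr mulrA.
  have -> : U1 = - (N * V) by move: UV; rewrite /U1; lra.
  have -> : UX + - Y * - (N * V) = C by rewrite /C; ring.
  rewrite -/W2 (_ : - 2 * eta * C = - (2 * eta * C)); last by ring.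
  rewrite lerD2l -[leRHS]mulrA ler_wpM2l ?sqr_ge0//.
  have h : 0 <= omega * (2 * D - q) by rewrite mulr_ge0 ?subr_ge0.
  have h2 : 0 <= omega * q / (2 * N).
    by rewrite divr_ge0 ?mulr_ge0 ?sumr_ge0 ?(ltW N0)// => i _; rewrite sqr_ge0.
  have -> : (1 + omega) * q - (s ^+ 2 + omega * q) / (2 * N)
    = D + omega * q - omega * q / (2 * N) by rewrite /D; field; lra.
  lra.
have eaftE : \sum_t w t * after t =
  gamma^-1 * (\sum_t w t * (\sum_i ((1 - chi) * X i + chi * (Y + dbar t)) ^+ 2
      + N * (Y + chi * dbar t) ^+ 2))
  + c * (\sum_t w t * (\sum_i (U i + eta * (dbar t - m i t * a i)) ^+ 2
      + N * (V + eta * dbar t) ^+ 2)).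
  rewrite !mulr_sumr -big_split/=; apply: eq_bigr => t _.
  by rewrite /after; ring.
have c0 : 0 < c by rewrite divr_gt0 ?mulr_gt0 ?exprn_gt0//; lra.
have h1 : p * (gamma^-1 * (X2 - chi * D)
    + c * (W2 - 2 * eta * C + eta ^+ 2 * (1 + 2 * omega) * D))
  = p * (gamma^-1 * X2 + c * W2) - 2 * C.
  by rewrite /c /eta; field; rewrite !gt_eqF//; lra.
have -> : gamma^-1 * (\sum_i (X i - gamma * U i) ^+ 2
      + N * (Y - gamma * V) ^+ 2) + (c - gamma) * (U2 + N * V ^+ 2)
  = gamma^-1 * X2 + c * W2 - 2 * C.
  have -> : \sum_i (X i - gamma * U i) ^+ 2 =
      P2 + (- 2 * gamma) * UX + gamma ^+ 2 * U2.
    by rewrite !mulr_sumr -!big_split; apply: eq_bigr => i _ /=; ring.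
  by rewrite /X2 /W2 /C; field; rewrite gt_eqF.
suff : p * (\sum_t w t * after t) <= p * (gamma^-1 * X2 + c * W2) - 2 * C.
  by rewrite /skipped -/X2 -/W2; lra.
rewrite -h1 ler_pM2l// eaftE lerD// ler_pM2l// invr_gt0//.
Qed.

(** * Moments of the rand-k compressor *)

Definition uniform_weight (R : realType) (d k : nat) (A : {set 'I_d}) : R :=
  if #|A| == k then 'C(d, k)%:R^-1 else 0.

Lemma sum_uniform_weight (R : realType) (d k : nat) (Q : pred {set 'I_d}) :
  \sum_(A | Q A) uniform_weight R k A
  = #|[set A : {set 'I_d} | Q A && (#|A| == k)]%SET|%:R / 'C(d, k)%:R.
Proof.
rewrite /uniform_weight -big_mkcondr/= sumr_const -[LHS]mulr_natl.
by congr (_%:R / _); apply: eq_card => A; rewrite !inE.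
Qed.

Lemma sum_uniform_weight1 (R : realType) (d k : nat) :
  (k <= d)%N -> \sum_A @uniform_weight R d k A = 1.
Proof.
move=> kd; rewrite sum_uniform_weight.
have -> : #|[set A : {set 'I_d} | true && (#|A| == k)]%SET| = 'C(d, k).
  by rewrite -[X in 'C(X, k)](card_ord d) -card_draws; apply: eq_card.
by rewrite divff// pnatr_eq0 -lt0n bin_gt0.
Qed.

(** Pascal's rule shows that C(d - 1, k - 1) of the subsets of size k contain j,
    and k C(d, k) = d C(d - 1, k - 1). *)
Lemma uniform_weight_mem (R : realType) (d k : nat) (j : 'I_d) :
  (0 < k)%N -> (k <= d)%N ->
  \sum_(A : {set 'I_d} | j \in A) @uniform_weight R d k A = k%:R / d%:R.
Proof.
move=> k0 kd; rewrite sum_uniform_weight.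
have d0 : (0 < d)%N by exact: leq_trans kd.
have E : #|[set A : {set 'I_d} | (j \in A) && (#|A| == k)]%SET| = 'C(d.-1, k.-1).
  have pascal : 'C(d, k) = ('C(d.-1, k) + 'C(d.-1, k.-1))%N.
    by move: d0 k0; clear; case: d => //; case: k => // *; rewrite binS.
  apply/eqP; rewrite -(eqn_add2l 'C(d.-1, k)) -pascal.
  have <- : #|[set A : {set 'I_d} | (A \subset ~: [set j]) && (#|A| == k)]%SET|
      = 'C(d.-1, k) by rewrite cards_draws cardsC1 card_ord.
  rewrite -[X in 'C(X, k)](card_ord d) -card_draws.
  rewrite -(cardsID [set A : {set 'I_d} | j \in A]%SET
    [set A : {set 'I_d} | #|A| == k]%SET).
  rewrite addnC; apply/eqP; congr (_ + _)%N; apply: eq_card => A; rewrite !inE.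
    by rewrite andbC.
  by rewrite finset.subsetC finset.sub1set inE.
rewrite E.
have := mul_bin_diag d k.-1; rewrite !prednK// => /(congr1 (fun x => x%:R : R)).
rewrite !natrM => H.
have C0 : 'C(d, k)%:R != 0 :> R by rewrite pnatr_eq0 -lt0n bin_gt0.
have dR : d%:R != 0 :> R by rewrite pnatr_eq0 -lt0n.
by apply/eqP; rewrite eqr_div// [X in X == _]mulrC H mulrC.
Qed.

Definition subsets_weight (R : realType) (n d k : nat)
    (A : {ffun 'I_n -> {set 'I_d}}) : R := \prod_i uniform_weight R k (A i).

Lemma expect_subset (R : realType) (n d k : nat) (G : {set 'I_d} -> R) (i : 'I_n) :
  (k <= d)%N ->
  \sum_A @subsets_weight R n d k A * G (A i)
  = \sum_B uniform_weight R k B * G B.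
Proof.
move=> kd.
pose F l B := uniform_weight R k B * (if l == i then G B else 1).
transitivity (\sum_(A : {ffun 'I_n -> {set 'I_d}}) \prod_l F l (A l)).
  apply: eq_bigr => A _; rewrite big_split/=; congr (_ * _).
  by rewrite -big_mkcond/= big_pred1_eq.
rewrite -bigA_distr_bigA (bigD1 i)//=.
have -> : \prod_(l < n | l != i) \sum_B F l B = 1.
  apply: big1 => l /negbTE li; rewrite /F li.
  by under eq_bigr do rewrite mulr1; rewrite sum_uniform_weight1.
by rewrite mulr1; apply: eq_bigr => B _; rewrite /F eqxx.
Qed.

Lemma expect_subset2 (R : realType) (n d k : nat) (G : {set 'I_d} -> R)
    (i j : 'I_n) : (k <= d)%N -> i != j ->
  \sum_A @subsets_weight R n d k A * (G (A i) * G (A j))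
  = (\sum_B uniform_weight R k B * G B) ^+ 2.
Proof.
move=> kd ij.
pose F l B := uniform_weight R k B * (if (l == i) || (l == j) then G B else 1).
transitivity (\sum_(A : {ffun 'I_n -> {set 'I_d}}) \prod_l F l (A l)).
  apply: eq_bigr => A _; rewrite big_split/=; congr (_ * _).
  rewrite -big_mkcond/= (bigD1 i) ?eqxx//=; congr (_ * _).
  rewrite (bigD1 j) ?eqxx ?orbT ?(eq_sym j)//= big1 ?mulr1// => l.
  by case: (l == i); case: (l == j).
rewrite -bigA_distr_bigA (bigD1 i)//= (bigD1 j) 1?eq_sym//=.
have -> : \prod_(l < n | (l != i) && (l != j)) \sum_B F l B = 1.
  apply: big1 => l /andP[/negbTE li /negbTE lj]; rewrite /F li lj.
  by under eq_bigr do rewrite mulr1; rewrite sum_uniform_weight1.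
rewrite mulr1 expr2.
by congr (_ * _); apply: eq_bigr => B _; rewrite /F eqxx ?orbT.
Qed.

Lemma sum_subsets_weight (R : realType) (n d k : nat) :
  (k <= d)%N -> \sum_A @subsets_weight R n d k A = 1.
Proof.
move=> kd; rewrite -(bigA_distr_bigA (fun (_ : 'I_n) => @uniform_weight R d k)).
by rewrite big1// => i _; rewrite sum_uniform_weight1.
Qed.

(** Rand-k acts on each coordinate as a multiplication by this factor. *)
Definition randk_factor (R : realType) (d k : nat) (j : 'I_d) (B : {set 'I_d}) : R :=
  if j \in B then d%:R / k%:R else 0.

Lemma expect_randk_factor (R : realType) (d k : nat) (j : 'I_d) :
  (0 < k)%N -> (k <= d)%N ->
  \sum_B uniform_weight R k B * randk_factor R k j B = 1.
Proof.
move=> k0 kd; have d0 : (0 < d)%N by exact: leq_trans kd.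
under eq_bigr do rewrite /randk_factor (fun_if (fun x => _ * x)) mulr0.
rewrite -big_mkcond -mulr_suml uniform_weight_mem//.
by field; rewrite !pnatr_eq0 -!lt0n k0 d0.
Qed.

Lemma expect_randk_factor_sqr (R : realType) (d k : nat) (j : 'I_d) :
  (0 < k)%N -> (k <= d)%N ->
  \sum_B uniform_weight R k B * randk_factor R k j B ^+ 2 = d%:R / k%:R.
Proof.
move=> k0 kd.
have -> : \sum_B uniform_weight R k B * randk_factor R k j B ^+ 2 =
    (\sum_B uniform_weight R k B * randk_factor R k j B) * (d%:R / k%:R).
  rewrite mulr_suml; apply: eq_bigr => B _; rewrite /randk_factor.
  by case: ifP => _; ring.
by rewrite expect_randk_factor// mul1r.
Qed.

(** * Expected decrease of the Lyapunov function in one step *)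

(** Each coordinate of the iterates is treated separately: the analysis of the
    random part does not use any relation between coordinates. *)
Lemma lyapunov_coordinates (R : realType) (n d : nat)
    (f : 'I_n -> 'rV[R]_d -> R) (g : 'rV[R]_d -> R)
    (gamma chi p omega : R) (xs : 'rV[R]_d) (s : locodl_state R n d) :
  lyapunov f g gamma chi p omega xs s =
  \sum_(j < d)
    (gamma^-1 * (\sum_i (st_x s i ord0 j - xs ord0 j) ^+ 2
                 + n%:R * (st_y s ord0 j - xs ord0 j) ^+ 2)
     + gamma * (1 + 2 * omega) / (p ^+ 2 * chi)
       * (\sum_i (st_u s i ord0 j - gradient (f i) xs ord0 j) ^+ 2
          + n%:R * (st_v s ord0 j - gradient g xs ord0 j) ^+ 2)).
Proof.
have E (F : 'I_n -> 'rV[R]_d) (z : 'rV[R]_d) :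
    \sum_i enorm (F i) ^+ 2 + n%:R * enorm z ^+ 2 =
    \sum_(j < d) (\sum_i F i ord0 j ^+ 2 + n%:R * z ord0 j ^+ 2).
  under eq_bigr do rewrite sqr_enorm.
  rewrite sqr_enorm /dot exchange_big mulr_sumr -big_split/=.
  by apply: eq_bigr => j _; under eq_bigr do rewrite -expr2; rewrite -expr2.
rewrite /lyapunov !E !mulr_sumr -big_split/=; apply: eq_bigr => j _.
congr (_ * (_ + _ * _ ^+ 2) + _ * (_ + _ * _ ^+ 2)); rewrite ?mxE//.
  by apply: eq_bigr => i _; rewrite !mxE.
by apply: eq_bigr => i _; rewrite !mxE.
Qed.

(** Invariance of the dual constraint: the increments of the u_i and of n v
    add up to eta (2 n dbar - sum d_i) = 0. *)
Lemma locodl_step_dual (R : realType) (n d : nat)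
    (f : 'I_n -> 'rV[R]_d -> R) (g : 'rV[R]_d -> R)
    (gamma chi rho p omega : R) (coin : bool)
    (C : 'I_n -> 'rV[R]_d -> 'rV[R]_d) (s : locodl_state R n d) :
  (0 < n)%N ->
  \sum_i st_u s i + n%:R *: st_v s = 0 ->
  let s' := locodl_step f g gamma chi rho p omega coin C s in
  \sum_i st_u s' i + n%:R *: st_v s' = 0.
Proof.
move=> n0 s0; case: coin => //=.
have nR : n%:R != 0 :> R by rewrite pnatr_eq0 -lt0n.
set db := (2 * n%:R)^-1 *: \sum_i _; set e := p * chi / _; clearbody e.
rewrite big_split/= -scaler_sumr [n%:R *: (_ + _)]scalerDr addrACA s0 add0r.
rewrite scalerA (mulrC n%:R) -scalerA -scalerDr sumrB sumr_const card_ord.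
rewrite -scaler_nat addrAC -scalerDl /db scalerA.
rewrite (_ : _ * _ = 1) ?scale1r ?subrr ?scaler0//.
by field.
Qed.

(** Sum [one_round_coordinate] over the coordinates, then bound the two squares
    that remain: the first by [gradient_step_contracts], the second by the
    hypothesis on [delta] that involves [p], which says delta c <= gamma. *)
Lemma expected_lyapunov_step (R : realType) (n d k : nat) (L mu delta : R)
    (f : 'I_n -> 'rV[R]_d -> R) (g : 'rV[R]_d -> R)
    (gamma chi p omega : R) (xs : 'rV[R]_d) (s : locodl_state R n d) :
  (0 < n)%N -> (0 < k)%N -> (k <= d)%N -> 0 < mu -> mu <= L ->
  (forall i z, differentiable (f i) z) -> (forall i, smooth L (f i)) ->
  (forall i, strongly_convex mu (f i)) ->
  (forall z, differentiable g z) -> smooth L g -> strongly_convex mu g ->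
  \sum_i gradient (f i) xs + n%:R *: gradient g xs = 0 ->
  \sum_i st_u s i + n%:R *: st_v s = 0 ->
  omega = d%:R / k%:R - 1 -> chi = n%:R / (n%:R + omega) ->
  0 < gamma -> 0 < p ->
  delta <= gamma * mu * (2 - gamma * mu) ->
  delta <= gamma * L * (2 - gamma * L) ->
  delta <= p ^+ 2 * chi / (1 + 2 * omega) ->
  let next coin (A : {ffun 'I_n -> {set 'I_d}}) := lyapunov f g gamma chi p omega xs
    (locodl_step f g gamma chi chi p omega coin (fun i => randk k (A i)) s) in
  is_true (\sum_A subsets_weight R k A * (p * next true A + (1 - p) * next false A)
    <= (1 - delta) * lyapunov f g gamma chi p omega xs s).
Proof.
move=> n0 k0 kd mu0 muL df fL fc dg gL gc opt inv omegaE chiE g0 p0 d1 d2 d3 next.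
have d0 : (0 < d)%N by exact: leq_trans kd.
have o0 : 0 <= omega.
  by rewrite omegaE subr_ge0 ler_pdivlMr ?ltr0n// mul1r ler_nat.
have N0 : 0 < n%:R :> R by rewrite ltr0n.
have chi0 : 0 < chi by rewrite chiE divr_gt0//; lra.
pose xh i := st_x s i - gamma *: gradient (f i) (st_x s i) + gamma *: st_u s i.
pose yh := st_y s - gamma *: gradient g (st_y s) + gamma *: st_v s.
pose X j i := xh i ord0 j - xs ord0 j.
pose Y j := yh ord0 j - xs ord0 j.
pose U j i := st_u s i ord0 j - gradient (f i) xs ord0 j.
pose V j := st_v s ord0 j - gradient g xs ord0 j.
pose c := gamma * (1 + 2 * omega) / (p ^+ 2 * chi).
have c0 : 0 < c by rewrite divr_gt0 ?mulr_gt0 ?exprn_gt0//; lra.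
pose eta := p * chi / (gamma * (1 + 2 * omega)).
pose m j i (A : {ffun 'I_n -> {set 'I_d}}) := randk_factor R k j (A i).
pose dbar j (A : {ffun 'I_n -> {set 'I_d}}) := (2 * n%:R)^-1 * \sum_i m j i A * (X j i - Y j).
pose after j (A : {ffun 'I_n -> {set 'I_d}}) :=
    gamma^-1 * (\sum_i ((1 - chi) * X j i + chi * (Y j + dbar j A)) ^+ 2
                + n%:R * (Y j + chi * dbar j A) ^+ 2)
    + c * (\sum_i (U j i + eta * (dbar j A - m j i A * (X j i - Y j))) ^+ 2
           + n%:R * (V j + eta * dbar j A) ^+ 2).
pose skipped j :=
    gamma^-1 * (\sum_i X j i ^+ 2 + n%:R * Y j ^+ 2)
    + c * (\sum_i U j i ^+ 2 + n%:R * V j ^+ 2).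
have nextF A : next false A = \sum_j skipped j.
  by rewrite /next lyapunov_coordinates.
have nextT A : next true A = \sum_j after j A.
  pose db := (2 * n%:R)^-1 *: \sum_i randk k (A i) (xh i - yh).
  have stepE : locodl_step f g gamma chi chi p omega true (fun i => randk k (A i)) s
    = {| st_x := fun i => (1 - chi) *: xh i + chi *: (yh + db);
         st_u := fun i => st_u s i + eta *: (db - randk k (A i) (xh i - yh));
         st_y := yh + chi *: db;
         st_v := st_v s + eta *: db |} by [].
  rewrite /next stepE lyapunov_coordinates; apply: eq_bigr => j _ /=.
  rewrite -/c {stepE}.
  have dE i : randk k (A i) (xh i - yh) ord0 j = m j i A * (X j i - Y j).
    rewrite /m /randk_factor /X /Y /xh /yh !mxE.
    by case: ifP => _; ring.
  have dbE : db ord0 j = dbar j A.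
    by rewrite mxE summxE; congr (_ * _); apply: eq_bigr => i _; rewrite dE.
  have addE (z v : 'rV[R]_d) : (z + v) ord0 j = z ord0 j + v ord0 j by rewrite mxE.
  have sclE (a : R) (z : 'rV[R]_d) : (a *: z) ord0 j = a * z ord0 j by rewrite mxE.
  have oppE (z : 'rV[R]_d) : (- z) ord0 j = - z ord0 j by rewrite mxE.
  move: dE dbE; move: (db) => D dE dbE.
  congr (_ * (_ + _ * _ ^+ 2) + _ * (_ + _ * _ ^+ 2)).
  - apply: eq_bigr => i _; rewrite addE !sclE (addE yh D) dbE /X /Y; ring.
  - by rewrite (addE yh) sclE dbE /Y; ring.
  - by apply: eq_bigr => i _; rewrite addE sclE (addE D) oppE dE dbE /U; ring.
  - by rewrite addE sclE dbE /V; ring.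
have UV j : \sum_i U j i + n%:R * V j = 0.
  have := congr1 (fun z : 'rV[R]_d => z ord0 j) inv.
  have := congr1 (fun z : 'rV[R]_d => z ord0 j) opt.
  rewrite mxE summxE [X in _ + X]mxE [RHS]mxE => h1.
  rewrite mxE summxE [X in _ + X]mxE [RHS]mxE => h2.
  rewrite /U /V sumrB; lra.
have coord j : p * (\sum_A subsets_weight R k A * after j A) + (1 - p) * skipped j
   <= gamma^-1 * (\sum_i (X j i - gamma * U j i) ^+ 2
                  + n%:R * (Y j - gamma * V j) ^+ 2)
      + (c - gamma) * (\sum_i U j i ^+ 2 + n%:R * V j ^+ 2).
  apply: one_round_coordinate => //.
  - exact: sum_subsets_weight.
  - by move=> i; rewrite expect_subset// expect_randk_factor.
  - move=> i; rewrite (expect_subset (fun B => randk_factor R k j B ^+ 2))//.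
    by rewrite expect_randk_factor_sqr// omegaE; ring.
  - by move=> i l il; rewrite expect_subset2// expect_randk_factor// expr1n.
have -> : \sum_A subsets_weight R k A * (p * next true A + (1 - p) * next false A)
    = \sum_j (p * (\sum_A subsets_weight R k A * after j A) + (1 - p) * skipped j).
  rewrite big_split/= -!mulr_sumr exchange_big/=.
  transitivity (p * (\sum_A subsets_weight R k A * \sum_j after j A)
    + (1 - p) * ((\sum_A @subsets_weight R n d k A) * \sum_j skipped j)).
    rewrite [in RHS]mulr_suml !mulr_sumr -big_split; apply: eq_bigr => A _ /=.
    by rewrite nextT nextF; ring.
  rewrite sum_subsets_weight// mul1r; congr (_ * _ + _).
  by apply: eq_bigr => A _; rewrite mulr_sumr.
apply: le_trans (ler_sum _ (fun j _ => coord j)) _.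
have cg : delta * c <= gamma.
  rewrite -(@ler_pM2r _ (p ^+ 2 * chi / (1 + 2 * omega) / gamma)).
    rewrite /c (_ : _ * _ * (_ / _) = delta); last by field; rewrite !gt_eqF//; lra.
    by rewrite (_ : gamma * _ = p ^+ 2 * chi / (1 + 2 * omega)) //; field;
      rewrite !gt_eqF//; lra.
  by rewrite !divr_gt0 ?mulr_gt0 ?exprn_gt0//; lra.
have contr (h : 'rV[R]_d -> R) (x : 'rV[R]_d) :
    (forall z, differentiable h z) -> smooth L h -> strongly_convex mu h ->
    \sum_j (x ord0 j - gamma * gradient h x ord0 j
            - (xs ord0 j - gamma * gradient h xs ord0 j)) ^+ 2
    <= (1 - delta) * \sum_j (x ord0 j - xs ord0 j) ^+ 2.
  move=> dh hL hc.
  have := gradient_step_contracts mu0 muL g0 d1 d2 dh hL hc x xs.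
  rewrite !sqr_enorm /dot; under eq_bigr do rewrite -expr2.
  under [X in _ <= _ * X -> _]eq_bigr do rewrite -expr2.
  have E1 j : (x - gamma *: gradient h x - (xs - gamma *: gradient h xs)) ord0 j
     = x ord0 j - gamma * gradient h x ord0 j
            - (xs ord0 j - gamma * gradient h xs ord0 j) by rewrite !mxE.
  have E2 j : (x - xs) ord0 j = x ord0 j - xs ord0 j by rewrite !mxE.
  by under eq_bigr do rewrite E1; under [X in _ <= _ * X -> _]eq_bigr do rewrite E2.
have XU j i : X j i - gamma * U j i = st_x s i ord0 j
    - gamma * gradient (f i) (st_x s i) ord0 j
    - (xs ord0 j - gamma * gradient (f i) xs ord0 j).
  by rewrite /X /U /xh !mxE; ring.
have YV j : Y j - gamma * V j = st_y s ord0 j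
    - gamma * gradient g (st_y s) ord0 j
    - (xs ord0 j - gamma * gradient g xs ord0 j).
  by rewrite /Y /V /yh !mxE; ring.
rewrite lyapunov_coordinates -/c !big_split/= -!mulr_sumr !big_split/=.
rewrite [leRHS]mulrDr; apply: lerD.
  rewrite [leRHS]mulrCA ler_pM2l ?invr_gt0// [leRHS]mulrDr; apply: lerD.
    rewrite exchange_big [X in _ <= _ * X]exchange_big/= mulr_sumr.
    apply: ler_sum => i _; under eq_bigr do rewrite XU.
    exact: contr.
  rewrite -!mulr_sumr [leRHS]mulrCA ler_pM2l//; under eq_bigr do rewrite YV.
  exact: contr.
rewrite [leRHS]mulrA; apply: ler_wpM2r.
  rewrite addr_ge0// sumr_ge0// => j _; first by rewrite sumr_ge0// => i _; exact: sqr_ge0.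
  by rewrite mulr_ge0 ?sqr_ge0// ltW.
lra.
Qed.

(** * Expectations over finite histories *)

(** The expectation of F (a_0, ..., a_(t-1)) for independent a_l of law [q],
    written as iterated sums with the most recent outcome innermost, so that a
    conditional expectation given the past is a sum over [a]. *)
Fixpoint history_sum (R : realType) (T : finType) (q : T -> R) (t : nat)
    (F : seq T -> R) : R :=
  if t is t'.+1 then history_sum q t' (fun h => \sum_a q a * F (rcons h a))
  else F [::].

Lemma history_sum_le (R : realType) (T : finType) (q : T -> R) (t : nat)
    (F G : seq T -> R) :
  (forall a, 0 <= q a) -> (forall h, F h <= G h) ->
  history_sum q t F <= history_sum q t G.
Proof.
move=> q0; elim: t F G => //= t IH F G FG; apply: IH => h.
by apply: ler_sum => a _; rewrite ler_wpM2l.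
Qed.

Lemma history_sumZ (R : realType) (T : finType) (q : T -> R) (t : nat)
    (F : seq T -> R) (c : R) :
  history_sum q t (fun h => c * F h) = c * history_sum q t F.
Proof.
elim: t F => //= t IH F; rewrite -IH; congr history_sum.
apply/funext => h; rewrite mulr_sumr.
by apply: eq_bigr => a _; rewrite mulrCA.
Qed.

Lemma history_sum_sum (R : realType) (T I : finType) (q : T -> R) (t : nat)
    (G : I -> seq T -> R) :
  history_sum q t (fun h => \sum_i G i h) = \sum_i history_sum q t (G i).
Proof.
elim: t G => //= t IH G; rewrite -IH; congr history_sum; apply/funext => h.
rewrite exchange_big/=; apply: eq_bigr => i _.
by rewrite mulr_sumr.
Qed.

(** A supermartingale argument without conditional expectations. *)
Lemma history_sum_contraction (R : realType) (T : finType) (q : T -> R)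
    (F : seq T -> R) (c : R) (t : nat) :
  (forall a, 0 <= q a) -> 0 <= c ->
  (forall h, \sum_a q a * F (rcons h a) <= c * F h) ->
  history_sum q t F <= c ^+ t * F [::].
Proof.
move=> q0 c0 step; elim: t => [|t IH]; first by rewrite mul1r.
apply: le_trans (_ : c * history_sum q t F <= _).
  by rewrite -history_sumZ /=; exact: history_sum_le.
by rewrite exprS -mulrA ler_wpM2l.
Qed.

Fixpoint cylinder (Omega : Type) (T : eqType) (out : nat -> Omega -> T)
    (m : nat) (c : seq T) : set Omega :=
  if c is a :: c' then out m @^-1` [set a] `&` cylinder out m.+1 c' else setT.

Lemma measurable_cylinder (disp : measure_display)
    (Omega : measurableType disp) (T : finType) (out : nat -> Omega -> T) m c :
  (forall l a, measurable (out l @^-1` [set a])) ->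
  measurable (cylinder out m c).
Proof.
move=> mout; elim: c m => [|a c IH] m /=; first exact: measurableT.
exact: measurableI.
Qed.

(** The event on later outcomes makes the induction on [m] work: the last of
    the first [m.+1] outcomes is moved, value by value, from the argument of [F]
    to the front of the cylinder. Only the law of cylinders, which is the case
    [m = 0], comes from the probability space. *)
Lemma expectation_history_cylinder (disp : measure_display)
    (Omega : measurableType disp) (R : realType) (P : probability Omega R)
    (T : finType) (out : nat -> Omega -> T) (q : T -> R) (m : nat) :
  (forall l a, measurable (out l @^-1` [set a])) ->
  (forall c, P (cylinder out 0 c) = (\prod_(a <- c) q a)%:E) ->
  forall (c : seq T) (F : seq T -> R), (forall h, 0 <= F h) ->
  let X w := F (mkseq (out^~ w) m) * \1_(cylinder out m c) w in
  measurable_fun setT X /\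
  (\int[P]_w (X w)%:E = (\prod_(a <- c) q a * history_sum q m F)%:E)%E.
Proof.
move=> mout law; elim: m => [|m IH] c F F0 X.
  have mI : measurable_fun setT (\1_(cylinder out 0 c) : Omega -> R).
    by apply: measurable_indic; exact: measurable_cylinder.
  split; first exact: (measurable_funM (measurable_cst (F [::])) mI).
  transitivity (\int[P]_w ((F [::])%:E * (\1_(cylinder out 0 c) w)%:E))%E.
    by apply: eq_integral => w _; rewrite -EFinM.
  rewrite ge0_integralZl_EFin//; last by apply/measurable_EFinP.
  rewrite integral_indic//; last exact: measurable_cylinder.
  rewrite setIT mulrC EFinM; congr (_ * _)%E; exact: law.
pose Y a w := F (rcons (mkseq (out^~ w) m) a) * \1_(cylinder out m (a :: c)) w.
have XE w : X w = \sum_a Y a w.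
  rewrite (bigD1 (out m w))//= big1 => [|a am].
    rewrite addr0 /X /Y mkseqS; congr (_ * _).
    rewrite !indicE /=; congr ((_ : bool)%:R).
    by apply/idP/idP; rewrite !inE => // -[].
  rewrite /Y indicE memNset ?mulr0//= => -[/= h _].
  by rewrite h eqxx in am.
have Y0 a w : 0 <= Y a w by rewrite mulr_ge0// indicE ler0n.
have H a := IH (a :: c) (fun h => F (rcons h a)) (fun h => F0 _).
have -> : X = (fun w => \sum_a Y a w) by apply/funext.
split; first by apply: measurable_sum => a; have [] := H a.
under eq_integral do rewrite -sumEFin.
have mY a : measurable_fun setT (fun w => (Y a w)%:E).
  by apply/measurable_EFinP; have [] := H a.
rewrite (ge0_integral_sum P measurableT mY); last first.
  by move=> a w _; rewrite lee_fin.
rewrite (eq_bigr _ (fun a _ => (H a).2)) sumEFin; congr EFin.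
rewrite /= history_sum_sum mulr_sumr; apply: eq_bigr => a _.
by rewrite history_sumZ big_cons; ring.
Qed.

Lemma expectation_history (disp : measure_display)
    (Omega : measurableType disp) (R : realType) (P : probability Omega R)
    (T : finType) (out : nat -> Omega -> T) (q : T -> R) (t : nat)
    (F : seq T -> R) :
  (forall l a, measurable (out l @^-1` [set a])) ->
  (forall c, P (cylinder out 0 c) = (\prod_(a <- c) q a)%:E) ->
  (forall h, 0 <= F h) ->
  'E_P[fun w => F (mkseq (out^~ w) t)]%E = (history_sum q t F)%:E.
Proof.
move=> mout law F0; rewrite unlock.
have [_ /=] := expectation_history_cylinder t mout law [::] F0.
rewrite big_nil mul1r => <-.
by apply: eq_integral => w _; rewrite indicT mulr1.
Qed.

(** * The law of the coins and subsets *)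

Lemma cylinderP (Omega : Type) (T : eqType) (out : nat -> Omega -> T)
    (a0 : T) (m : nat) (c : seq T) (w : Omega) :
  cylinder out m c w <->
  (forall l, (l < size c)%N -> out (m + l)%N w = nth a0 c l).
Proof.
elim: c m => [|a c IH] m /=; first by split.
split=> [[<- /IH h] [|l] lc|h]; first by rewrite addn0.
  by rewrite addnS -addSn h.
split; first by have := h 0%N; rewrite addn0; exact.
by apply/IH => l lc; rewrite addSn -addnS (h l.+1).
Qed.

Definition outcome (Omega : Type) (n d : nat) (theta : nat -> Omega -> bool)
    (S : nat -> 'I_n -> Omega -> {set 'I_d}) (t : nat) (w : Omega) :
    bool * {ffun 'I_n -> {set 'I_d}} :=
  (theta t w, [ffun i => S t i w]).

Definition outcome_weight (R : realType) (n d k : nat) (p : R)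
    (a : bool * {ffun 'I_n -> {set 'I_d}}) : R :=
  (if a.1 then p else 1 - p) * subsets_weight R k a.2.

Lemma outcome_preimage (Omega : Type) (n d : nat) (theta : nat -> Omega -> bool)
    (S : nat -> 'I_n -> Omega -> {set 'I_d}) (t : nat)
    (a : bool * {ffun 'I_n -> {set 'I_d}}) (w : Omega) :
  outcome theta S t w = a <->
  theta t w = a.1 /\ forall i, S t i w = a.2 i.
Proof.
rewrite /outcome; case: a => b A /=; split=> [[-> <-]|[-> h]].
  by split=> // i; rewrite ffunE.
by congr pair; apply/ffunP => i; rewrite ffunE.
Qed.

Lemma measurable_outcome (disp : measure_display)
    (Omega : measurableType disp) (R : realType) (P : probability Omega R)
    (n d k : nat) (p : R) (theta : nat -> Omega -> bool)
    (S : nat -> 'I_n -> Omega -> {set 'I_d}) :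
  (forall t, bernoulli_coin P p (theta t)) ->
  (forall t i, uniform_subset P k (S t i)) ->
  forall t a, measurable (outcome theta S t @^-1` [set a]).
Proof.
move=> ht hS t a.
have -> : outcome theta S t @^-1` [set a] =
    theta t @^-1` [set a.1] `&` \bigcap_(i in [set: 'I_n]) (S t i @^-1` [set a.2 i]).
  apply/seteqP; split => w.
    by move=> /outcome_preimage[ta Sa]; split=> // i _; exact: Sa.
  by move=> -[ta Sa]; apply/outcome_preimage; split=> // i; exact: Sa.
apply: measurableI.
  by rewrite -[X in measurable X]setTI; apply: (ht t).1.
apply: fin_bigcap_measurable => // i _.
by have [] := hS t i (a.2 i).
Qed.

(** Fixing the first outcomes is an intersection of events on the individual
    coins and subsets, one for each index in the list [js]; mutual independence
    for that list gives the product. *)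
Lemma outcome_law (disp : measure_display)
    (Omega : measurableType disp) (R : realType) (P : probability Omega R)
    (n d k : nat) (p : R) (theta : nat -> Omega -> bool)
    (S : nat -> 'I_n -> Omega -> {set 'I_d}) :
  (forall t, bernoulli_coin P p (theta t)) ->
  (forall t i, uniform_subset P k (S t i)) ->
  mutually_independent P (locodl_events theta S) ->
  forall c, P (cylinder (outcome theta S) 0 c)
            = (\prod_(a <- c) outcome_weight k p a)%:E.
Proof.
move=> ht hS ind c.
pose a0 : bool * {ffun 'I_n -> {set 'I_d}} := (false, [ffun=> finset.set0]).
pose js : seq (nat + nat * 'I_n) := [seq inl l | l <- iota 0 (size c)] ++
  [seq inr li | li <- [seq (l, i) | l <- iota 0 (size c), i <- enum 'I_n]].
pose ev (j : nat + nat * 'I_n) : set Omega := match j with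
  | inl l => theta l @^-1` [set (nth a0 c l).1]
  | inr (l, i) => S l i @^-1` [set (nth a0 c l).2 i] end.
pose r (j : nat + nat * 'I_n) : R := match j with
  | inl l => if (nth a0 c l).1 then p else 1 - p
  | inr (l, i) => uniform_weight R k ((nth a0 c l).2 i) end.
have Pev j : P (ev j) = (r j)%:E.
  case: j => [l|[l i]] /=; last by have [] := hS l i ((nth a0 c l).2 i).
  have [mt pt] := ht l; case: (nth a0 c l).1 => //.
  rewrite (_ : _ @^-1` _ = ~` (theta l @^-1` [set true])); last first.
    by apply/seteqP; split => w /=; case: (theta l w).
  rewrite probability_setC; first by rewrite pt.
  by rewrite -[X in measurable X]setTI; exact: mt.
have -> : cylinder (outcome theta S) 0 c = \bigcap_(j in [set` js]) ev j.
  apply/seteqP; split => w.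
    move=> /(cylinderP _ a0) h j; rewrite /= mem_cat => /orP[/mapP[l]|/mapP[li]].
      by rewrite mem_iota /= => lc ->; have /outcome_preimage[] := h l lc.
    move=> /allpairsP[[l i]] /= [+ _ ->] ->; rewrite mem_iota /= => lc.
    by have /outcome_preimage[_] := h l lc; exact.
  move=> h; apply/(cylinderP _ a0) => l lc; apply/outcome_preimage.
  have li : l \in iota 0 (size c) by rewrite mem_iota.
  split=> [|i].
    by apply: (h (inl l)); rewrite /= mem_cat map_f.
  apply: (h (inr (l, i))); rewrite /= mem_cat; apply/orP; right.
  by rewrite map_f//; apply: allpairs_f => //; rewrite mem_enum.
rewrite ind; last 2 first.
- have injl : injective (@inl nat (nat * 'I_n)) by move=> ? ? [].
  have injr : injective (@inr nat (nat * 'I_n)) by move=> ? ? [].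
  rewrite cat_uniq (map_inj_uniq injl) (map_inj_uniq injr) iota_uniq /=.
  rewrite allpairs_uniq ?iota_uniq ?enum_uniq//; last by move=> [? ?] [? ?].
  by rewrite andbT; apply/hasPn => j /mapP[li _ ->]; apply/mapP => -[].
- move=> j _; case: j => [l|[l i]] /=.
    by exists [set (nth a0 c l).1] => //; rewrite setTI.
  by exists [set (nth a0 c l).2 i] => //; rewrite setTI.
rewrite (eq_bigr (fun j => (r j)%:E)) => [|j _]; last exact: Pev.
rewrite prodEFin; congr EFin.
rewrite big_cat !big_map big_allpairs /= -big_split (big_nth a0) /index_iota subn0.
apply: eq_bigr => l _ /=; rewrite /outcome_weight; congr (_ * _).
by rewrite /subsets_weight big_enum.
Qed.

(** * Linear convergence *)

(** The expectation of the Lyapunov function becomes a finite sum because the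
    state depends on finitely many outcomes only. *)
Lemma locodl_foldl (Omega : Type) (R : realType) (n d k : nat)
    (f : 'I_n -> 'rV[R]_d -> R) (g : 'rV[R]_d -> R)
    (gamma chi rho p omega : R) (theta : nat -> Omega -> bool)
    (S : nat -> 'I_n -> Omega -> {set 'I_d}) (s0 : locodl_state R n d)
    (t : nat) (w : Omega) :
  locodl f g gamma chi rho p omega
    (fun t' => theta t' w) (fun t' i => randk k (S t' i w)) s0 t =
  foldl (fun s (a : bool * {ffun 'I_n -> {set 'I_d}}) =>
                     locodl_step f g gamma chi rho p omega a.1
                      (fun i => randk k (a.2 i)) s)
    s0 (mkseq (fun l => outcome theta S l w) t).
Proof.
elim: t => [//|t IH]; rewrite mkseqS foldl_rcons -IH /=.
by congr locodl_step; apply/funext => i; rewrite ffunE.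
Qed.

Lemma lyapunov_ge0 (R : realType) (n d : nat)
    (f : 'I_n -> 'rV[R]_d -> R) (g : 'rV[R]_d -> R)
    (gamma chi p omega : R) (xs : 'rV[R]_d) (s : locodl_state R n d) :
  0 <= gamma -> 0 <= chi -> 0 <= omega ->
  0 <= lyapunov f g gamma chi p omega xs s.
Proof.
move=> g0 chi0 o0; rewrite /lyapunov.
have N (F : 'I_n -> 'rV[R]_d) (z : 'rV[R]_d) :
    0 <= \sum_i enorm (F i) ^+ 2 + n%:R * enorm z ^+ 2.
  apply: addr_ge0; first by apply: sumr_ge0 => i _; exact: sqr_ge0.
  by apply: mulr_ge0 => //; exact: sqr_ge0.
apply: addr_ge0; apply: mulr_ge0 => //; first by rewrite invr_ge0.
by apply: divr_ge0; apply: mulr_ge0 => //; [lra|exact: sqr_ge0].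
Qed.

Lemma subsets_weight_ge0 (R : realType) (n d k : nat)
    (A : {ffun 'I_n -> {set 'I_d}}) : 0 <= subsets_weight R k A.
Proof.
apply: prodr_ge0 => i _; rewrite /uniform_weight.
by case: ifP => _; rewrite ?invr_ge0.
Qed.

Lemma expected_lyapunov_decay (R : realType) (n d k : nat) (L mu delta : R)
    (f : 'I_n -> 'rV[R]_d -> R) (g : 'rV[R]_d -> R)
    (gamma chi p omega : R) (xs : 'rV[R]_d) (s0 : locodl_state R n d)
    (disp : measure_display) (Omega : measurableType disp)
    (P : probability Omega R) (theta : nat -> Omega -> bool)
    (S : nat -> 'I_n -> Omega -> {set 'I_d}) (t : nat) :
  (0 < n)%N -> (0 < k)%N -> (k <= d)%N -> 0 < mu -> mu <= L ->
  (forall i z, differentiable (f i) z) -> (forall i, smooth L (f i)) ->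
  (forall i, strongly_convex mu (f i)) ->
  (forall z, differentiable g z) -> smooth L g -> strongly_convex mu g ->
  \sum_i gradient (f i) xs + n%:R *: gradient g xs = 0 ->
  \sum_i st_u s0 i + n%:R *: st_v s0 = 0 ->
  omega = d%:R / k%:R - 1 -> chi = n%:R / (n%:R + omega) ->
  0 < gamma -> 0 < p <= 1 ->
  delta <= gamma * mu * (2 - gamma * mu) ->
  delta <= gamma * L * (2 - gamma * L) ->
  delta <= p ^+ 2 * chi / (1 + 2 * omega) ->
  (forall t, bernoulli_coin P p (theta t)) ->
  (forall t i, uniform_subset P k (S t i)) ->
  mutually_independent P (locodl_events theta S) ->
  ('E_P[fun w => lyapunov f g gamma chi p omega xs
      (locodl f g gamma chi chi p omega (fun t' => theta t' w)
        (fun t' i => randk k (S t' i w)) s0 t)]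
   <= ((1 - delta) ^+ t * lyapunov f g gamma chi p omega xs s0)%:E)%E.
Proof.
move=> n0 k0 kd mu0 muL df fL fc dg gL gc opt inv omegaE chiE g0 /andP[p0 p1].
move=> d1 d2 d3 ht hS ind.
have o0 : 0 <= omega.
  by rewrite omegaE subr_ge0 ler_pdivlMr ?ltr0n// mul1r ler_nat.
have chi0 : 0 <= chi by rewrite chiE divr_ge0// addr_ge0.
pose run := foldl (fun s (a : bool * {ffun 'I_n -> {set 'I_d}}) =>
  locodl_step f g gamma chi chi p omega a.1 (fun i => randk k (a.2 i)) s) s0.
pose Phi h := lyapunov f g gamma chi p omega xs (run h).
under [X in ('E_P[X] <= _)%E]eq_fun do rewrite locodl_foldl.
rewrite (expectation_history (F := Phi) t (measurable_outcome ht hS)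
  (outcome_law ht hS ind)); last by move=> h; apply: lyapunov_ge0 => //; exact: ltW.
rewrite lee_fin; apply: history_sum_contraction.
- move=> a; rewrite /outcome_weight mulr_ge0 ?subsets_weight_ge0//.
  by case: ifP; rewrite ?subr_ge0 // ltW.
- have : 0 <= (1 - gamma * mu) ^+ 2 by exact: sqr_ge0.
  by move: d1; lra.
- move=> h.
  have run_inv : \sum_i st_u (run h) i + n%:R *: st_v (run h) = 0.
    elim/last_ind: h => [|h a IH]; first exact: inv.
    by rewrite /run foldl_rcons; exact: locodl_step_dual.
  have := expected_lyapunov_step n0 k0 kd mu0 muL df fL fc dg gL gc opt run_inv
    omegaE chiE g0 p0 d1 d2 d3.
  apply: le_trans.
  have -> : \sum_a outcome_weight k p a * Phi (rcons h a) =
      \sum_b \sum_A outcome_weight k p (b, A) * Phi (rcons h (b, A)).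
    by rewrite pair_bigA; apply: eq_bigr => -[].
  rewrite exchange_big/=.
  apply: ler_sum => A _; rewrite big_bool /outcome_weight/= /Phi /run !foldl_rcons/=.
  lra.
Qed.

Lemma geometric_le (R : realType) (delta eps : R) (t : nat) :
  delta <= 1 -> 0 < eps -> ln eps^-1 <= delta * t%:R -> (1 - delta) ^+ t <= eps.
Proof.
move=> d1 e0 h.
have h1 : 1 - delta <= expR (- delta) by exact: expR_ge1Dx.
apply: le_trans (_ : expR (- delta) ^+ t <= _).
  by rewrite lerXn2r// nnegrE ?subr_ge0// expR_ge0.
rewrite -expRM_natl -[leRHS](@lnK _ eps)// ler_expR.
by move: h; rewrite lnV//; lra.
Qed.

Lemma iteration_complexity_exists (disp : measure_display)
    (Omega : measurableType disp) (R : realType) (P : probability Omega R)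
    (Psi : nat -> Omega -> R) (Psi0 eps : R) (T0 : nat) :
  accurate_after P Psi Psi0 eps T0 ->
  exists2 T, iteration_complexity P Psi Psi0 eps T & (T <= T0)%N.
Proof.
move=> h.
have ex : exists T, `[< accurate_after P Psi Psi0 eps T >].
  by exists T0; exact/asboolP.
case: (ex_minnP ex) => T /asboolP aT minT; exists T.
  by split=> // T' /asboolP; exact: minT.
by apply: minT; exact/asboolP.
Qed.

(** * Parameters and the number of reals sent *)

(** With w = D / K the radicand is w / (chi kappa). When the minimum is the
    square root, the rate is w / ((2 w - 1) kappa) >= 1 / (2 kappa); when it is
    1, the rate is chi / (2 w - 1) >= 1 / (4 w), because w <= N gives
    chi >= 1 / 2. *)
Lemma sqr_coin_rate (R : realType) (D N K kappa p chi omega : R) :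
  1 <= N -> 0 < K -> K <= D -> D <= K * N -> 1 <= kappa ->
  omega = D / K - 1 -> chi = N / (N + omega) ->
  p = Num.min (Num.sqrt ((D * K * (N - 1) + D ^+ 2) / (N * K ^+ 2 * kappa))) 1 ->
  (4 * (kappa + D / K))^-1 <= p ^+ 2 * chi / (1 + 2 * omega).
Proof.
move=> N1 K0 KD DKN k1 omegaE chiE pE.
pose w := D / K.
have w1 : 1 <= w by rewrite /w ler_pdivlMr// mul1r.
have wN : w <= N by rewrite /w ler_pdivrMr// mulrC.
have {}omegaE : omega = w - 1 by [].
have chi2 : 1 / 2 <= chi by rewrite chiE ler_pdivlMr; rewrite omegaE; lra.
have Q : (D * K * (N - 1) + D ^+ 2) / (N * K ^+ 2 * kappa) = w / (chi * kappa).
  rewrite chiE omegaE -[D in LHS](divfK (lt0r_neq0 K0)) -/w; field.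
  by rewrite !gt_eqF//; lra.
rewrite -/w; clearbody w.
have w2 : 1 + 2 * omega = 2 * w - 1 by rewrite omegaE; ring.
rewrite w2 pE; case: (lerP _ 1) => _.
  rewrite Q sqr_sqrtr; last by apply: divr_ge0; [lra|apply: mulr_ge0; lra].
  have -> : w / (chi * kappa) * chi / (2 * w - 1) = w / ((2 * w - 1) * kappa).
    by field; rewrite !gt_eqF//; lra.
  rewrite ler_pdivlMr; last by rewrite mulr_gt0; lra.
  rewrite ler_pdivrMl; last by lra.
  nra.
rewrite expr1n mul1r ler_pdivlMr; last by lra.
rewrite ler_pdivrMl; last by lra.
nra.
Qed.

(** The summand K p D / K is at most D because p <= 1. For the other one, p is
    bounded by the square root, and
      (K kappa)^2 Q = kappa (D K (N - 1) / N + D^2 / N)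
                    <= kappa (2 D^2 / N + D)
    since K <= D / N + 1; this is below the square of the claimed bound. *)
Lemma uplink_per_contraction (R : realType) (D N K kappa p : R) :
  1 <= N -> 0 < K -> 0 < D -> K <= D / N + 1 -> 0 < kappa ->
  p = Num.min (Num.sqrt ((D * K * (N - 1) + D ^+ 2) / (N * K ^+ 2 * kappa))) 1 ->
  K * (p * (kappa + D / K))
  <= 2 * (Num.sqrt D * Num.sqrt kappa + D * Num.sqrt kappa / Num.sqrt N + D).
Proof.
move=> N1 K0 D0 KDN k0 pE.
have N0 : 0 < N by lra.
set Q := _ / (N * _ * _) in pE.
have DK0 : 0 <= D * K * (N - 1) + D ^+ 2.
  by rewrite addr_ge0 ?sqr_ge0// mulr_ge0 ?mulr_ge0//; lra.
have Q0 : 0 <= Q by rewrite divr_ge0// ?mulr_ge0 ?sqr_ge0// ltW.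
have pQ : p <= Num.sqrt Q by rewrite pE ge_min lexx.
have p1 : p <= 1 by rewrite pE ge_min lexx orbT.
pose sd := Num.sqrt D; pose sk := Num.sqrt kappa; pose sn := Num.sqrt N.
have sd0 : 0 < sd by rewrite sqrtr_gt0.
have sk0 : 0 < sk by rewrite sqrtr_gt0.
have sn0 : 0 < sn by rewrite sqrtr_gt0.
have sdE : sd ^+ 2 = D by rewrite sqr_sqrtr ?ltW.
have skE : sk ^+ 2 = kappa by rewrite sqr_sqrtr ?ltW.
have snE : sn ^+ 2 = N by rewrite sqr_sqrtr ?ltW.
have main : K * kappa * Num.sqrt Q <= 2 * (sd * sk + D * sk / sn).
  have B0 : 0 <= 2 * (sd * sk + D * sk / sn).
    by rewrite mulr_ge0// addr_ge0 ?divr_ge0 ?mulr_ge0// ltW.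
  rewrite -(@ler_pXn2r _ 2)// ?nnegrE ?mulr_ge0 ?sqrtr_ge0 ?(ltW K0) ?(ltW k0)//.
  rewrite exprMn sqr_sqrtr//.
  have -> : (K * kappa) ^+ 2 * Q = kappa * (D * K * (N - 1) / N + D ^+ 2 / N).
    by rewrite /Q; field; rewrite !gt_eqF.
  have -> : (2 * (sd * sk + D * sk / sn)) ^+ 2
      = kappa * (4 * D + 4 * (D ^+ 2 / N) + 8 * (D * (sd / sn))).
    by rewrite -sdE -skE -snE; field; rewrite gt_eqF.
  rewrite ler_pM2l//.
  have h1 : 0 <= D * (sd / sn) by rewrite mulr_ge0 ?divr_ge0// ltW.
  have h2 : D * K * (N - 1) / N <= D * K.
    by rewrite ler_pdivrMr// ler_pM2l ?mulr_gt0//; lra.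
  have h3 : D * K <= D ^+ 2 / N + D.
    have -> : D ^+ 2 / N + D = D * (D / N + 1) by field; rewrite gt_eqF.
    by rewrite ler_pM2l.
  have h4 : 0 <= D ^+ 2 / N by rewrite divr_ge0 ?sqr_ge0// ltW.
  lra.
have -> : K * (p * (kappa + D / K)) = K * kappa * p + p * D.
  by field; rewrite gt_eqF.
have h1 : K * kappa * p <= K * kappa * Num.sqrt Q by rewrite ler_pM2l// mulr_gt0.
have h2 : p * D <= 1 * D by rewrite ler_pM2r.
rewrite -/sd -/sk -/sn; lra.
Qed.

(** * The complexity bound *)

Theorem corollary3p2 (R : realType) (c1 c2 : R)
    (hc1 : 0 < c1) (hc12 : c1 <= c2) (hc2 : c2 < 2) :
  exists C : R, 0 < C /\
  forall (d n : nat) (L mu : R)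
    (f : 'I_n -> 'rV[R]_d -> R) (g : 'rV[R]_d -> R) (xstar : 'rV[R]_d)
    (gamma chi rho p omega : R) (k : nat)
    (x0 u0 : 'I_n -> 'rV[R]_d) (y0 v0 : 'rV[R]_d)
    (disp : measure_display) (Omega : measurableType disp)
    (P : probability Omega R)
    (theta : nat -> Omega -> bool)
    (S : nat -> 'I_n -> Omega -> {set 'I_d})
    (eps : R),
  let kappa := L / mu in
  let s0 := LocodlState x0 u0 y0 v0 in
  let Psi (t : nat) (w : Omega) :=
    lyapunov f g gamma chi p omega xstar
      (locodl f g gamma chi rho p omega
        (fun t' => theta t' w) (fun t' i => randk k (S t' i w)) s0 t) in
  let Psi0 := lyapunov f g gamma chi p omega xstar s0 in
  (0 < d)%N -> (0 < n)%N -> 0 < mu -> mu <= L ->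
  (forall (i : 'I_n) (x : 'rV[R]_d), differentiable (f i) x) ->
  (forall i : 'I_n, smooth L (f i)) ->
  (forall i : 'I_n, strongly_convex mu (f i)) ->
  (forall x : 'rV[R]_d, differentiable g x) ->
  smooth L g -> strongly_convex mu g ->
  minimizer (fun x => n%:R^-1 * (\sum_(i < n) f i x) + g x) xstar ->
  n%:R^-1 *: (\sum_(i < n) u0 i) + v0 = 0 ->
  k%:Z = Num.ceil (d%:R / n%:R : R) ->
  omega = d%:R / k%:R - 1 ->
  0 < gamma -> gamma < 2 / L -> c1 / L <= gamma -> gamma <= c2 / L ->
  chi = n%:R / (n%:R - 1 + d%:R / k%:R) ->
  rho = n%:R / (n%:R - 1 + d%:R / k%:R) ->
  p = Num.min (Num.sqrt ((d%:R * k%:R * (n%:R - 1) + d%:R ^+ 2)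
                         / (n%:R * k%:R ^+ 2 * kappa))) 1 ->
  (forall t : nat, bernoulli_coin P p (theta t)) ->
  (forall (t : nat) (i : 'I_n), uniform_subset P k (S t i)) ->
  mutually_independent P (locodl_events theta S) ->
  0 < eps -> eps <= 1 / 2 ->
  exists T : nat,
    iteration_complexity P Psi Psi0 eps T /\
    uplink_reals k p T
      <= C * ((Num.sqrt d%:R * Num.sqrt kappa
               + d%:R * Num.sqrt kappa / Num.sqrt n%:R + d%:R)
              * ln (eps^-1)).
Proof.
pose C0 := Num.min (c1 * (2 - c2)) 4^-1.
have C00 : 0 < C0 by rewrite lt_min mulr_gt0//= ?invr_gt0//; lra.
have C0a : C0 <= c1 * (2 - c2) by rewrite ge_min lexx.
have C0b : C0 <= 4^-1 by rewrite ge_min lexx orbT.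
exists (2 * (C0^-1 + 2)); split; first by rewrite mulr_gt0 ?addr_gt0 ?invr_gt0.
move=> d n L mu f g xs gamma chi rho p omega k x0 u0 y0 v0 disp Omega P theta S
  eps kappa s0 Psi Psi0 d0 n0 mu0 muL df fL fc dg gL gc xmin uv kE omegaE
  g0 gL2 gc1 gc2 chiE rhoE pE ht hS ind e0 e2.
have L0 : 0 < L by lra.
have N0 : 0 < n%:R :> R by rewrite ltr0n.
have D0 : 0 < d%:R :> R by rewrite ltr0n.
have kap1 : 1 <= kappa by rewrite ler_pdivlMr// mul1r.
have kapE : kappa = L / mu by [].
clearbody kappa.
have /andP[kl ku] := ceil_itv (d%:R / n%:R : R).
rewrite -kE in kl ku.
have kR : (k%:Z)%:~R = k%:R :> R by [].
rewrite intrB kR in kl; rewrite kR in ku.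
have K0 : 0 < k%:R :> R by apply: lt_le_trans ku; rewrite divr_gt0.
have k0 : (0 < k)%N by rewrite -(ltr0n R).
have kd : (k <= d)%N.
  rewrite -lez_nat kE ceil_le_int ler_pdivrMr//.
  by apply: ler_peMr; rewrite ?ler1n// ltW.
have KD : k%:R <= d%:R :> R by rewrite ler_nat.
have DKN : d%:R <= k%:R * n%:R :> R by rewrite -ler_pdivrMr.
have N1 : 1 <= n%:R :> R by rewrite ler1n.
have w1 : 1 <= d%:R / k%:R :> R by rewrite ler_pdivlMr// mul1r.
have chiE' : chi = n%:R / (n%:R + omega) by rewrite chiE omegaE; congr (_ / _); ring.
have rhochi : rho = chi by rewrite rhoE chiE.
have p01 : 0 < p <= 1.
  rewrite pE lt_min ltr01 ge_min lexx orbT !andbT sqrtr_gt0.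
  apply: divr_gt0; last by rewrite !mulr_gt0 ?exprn_gt0//; lra.
  apply: ltr_wpDl; last exact: exprn_gt0.
  by apply: mulr_ge0; [apply: mulr_ge0 | lra].
(* Up to a factor 2 this is C0 min (1 / kappa, k / d): the gradient steps allow
   a rate of order 1 / kappa, the coin one of order min (1 / kappa, k / d). *)
pose delta := C0 / (kappa + d%:R / k%:R).
have s1 : 0 < kappa + d%:R / k%:R by lra.
have delta0 : 0 < delta by rewrite divr_gt0.
have dkap : delta <= C0 / kappa by rewrite ler_pM2l// lef_pV2 ?posrE//; lra.
have dC : delta <= C0 by rewrite ler_pdivrMr// ler_peMr ?ltW//; lra.
have gL0 : c1 <= gamma * L by rewrite -ler_pdivrMr.
have gLc2 : gamma * L <= c2 by rewrite -ler_pdivlMr.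
have rate_mu : delta <= gamma * mu * (2 - gamma * mu).
  apply: le_trans dkap _; rewrite ler_pdivrMr; last by lra.
  have -> : gamma * mu * (2 - gamma * mu) * kappa = gamma * L * (2 - gamma * mu).
    by rewrite kapE; field; lra.
  apply: le_trans C0a _; apply: ler_pM => //; [lra|lra|].
  have : gamma * mu <= gamma * L by rewrite ler_pM2l.
  lra.
have rate_L : delta <= gamma * L * (2 - gamma * L).
  apply: le_trans dC _; apply: le_trans C0a _; apply: ler_pM => //; lra.
have rate_p : delta <= p ^+ 2 * chi / (1 + 2 * omega).
  apply: le_trans (sqr_coin_rate N1 K0 KD DKN kap1 omegaE chiE' pE).
  by rewrite invfM ler_pM2r ?invr_gt0.
have opt := minimizer_gradient n0 L0 df fL dg gL xmin.
have dual : \sum_i st_u s0 i + n%:R *: st_v s0 = 0.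
  have := congr1 (fun z => n%:R *: z) uv.
  by rewrite scaler0 scalerDr scalerA divff ?scale1r ?gt_eqF.
have Psi00 : 0 <= Psi0.
  apply: lyapunov_ge0; first exact: ltW.
    by rewrite chiE' divr_ge0//; lra.
  by lra.
pose T0 := (Num.truncn (ln eps^-1 / delta)).+1.
have acc : accurate_after P Psi Psi0 eps T0.
  move=> t Tt.
  have := expected_lyapunov_decay t n0 k0 kd mu0 muL df fL fc dg gL gc opt dual
    omegaE chiE' g0 p01 rate_mu rate_L rate_p ht hS ind.
  rewrite /Psi rhochi => /le_trans; apply; rewrite lee_fin ler_wpM2r//.
  apply: geometric_le => //; first by nra.
  rewrite mulrC -ler_pdivrMr//; apply: le_trans (ltW (truncnS_gt _)) _.
  by rewrite ler_nat.
have [T hT TT0] := iteration_complexity_exists acc.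
exists T; split=> //.
(* As eps <= 1/2, the rounding up of T is absorbed in the logarithm. *)
have ln0 : 1 / 2 <= ln eps^-1.
  rewrite lnV ?posrE// -[1 / 2]opprK lerN2 -ler_expR lnK ?posrE//.
  by apply: le_trans e2 _; apply: le_trans (expR_ge1Dx _); lra.
have TR : T%:R <= ln eps^-1 / delta + 1.
  apply: (@le_trans _ _ T0%:R); first by rewrite ler_nat.
  by rewrite -natr1 lerD2r truncn_le; apply: divr_ge0; lra.
have TR2 : T%:R <= (C0^-1 + 2) * (kappa + d%:R / k%:R) * ln eps^-1.
  apply: le_trans TR _.
  have -> : ln eps^-1 / delta = C0^-1 * (kappa + d%:R / k%:R) * ln eps^-1.
    rewrite /delta; move: s1; set s := kappa + _ => s1; clearbody s.
    by field; rewrite !gt_eqF.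
  have : 1 <= 2 * ((kappa + d%:R / k%:R) * ln eps^-1) by nra.
  lra.
rewrite /uplink_reals /communication_rounds.
have /andP[p0 _] := p01.
apply: (@le_trans _ _
  (k%:R * (p * ((C0^-1 + 2) * (kappa + d%:R / k%:R) * ln eps^-1)))).
  by rewrite ler_pM2l// ler_pM2l.
have -> : k%:R * (p * ((C0^-1 + 2) * (kappa + d%:R / k%:R) * ln eps^-1)) =
  (C0^-1 + 2) * ln eps^-1 * (k%:R * (p * (kappa + d%:R / k%:R))) by ring.
have KDN : k%:R <= d%:R / n%:R + 1 :> R by lra.
have kap0 : 0 < kappa by lra.
have := uplink_per_contraction N1 K0 D0 KDN kap0 pE.
set B := _ + d%:R => hB.
rewrite [leRHS](_ : _ = (C0^-1 + 2) * ln eps^-1 * (2 * B)); last by ring.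
apply: ler_wpM2l => //.
by rewrite mulr_ge0 ?addr_ge0 ?invr_ge0 ?ltW//; lra.
Qed.
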